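(* Let $k\ge 3$ and $\frac1k<r_0<\frac1{k-1}$, with $\sigma_k$, $L_j$, $m_j$ as in the context. Then the conditional probability generating function of $\sigma_k$ given $m_1,\dots,m_{k-1}$ is $$\mathbb E\big[q^{\sigma_k}\,\big|\,m_1,\dots,m_{k-1}\big]=\frac{1}{\binom{m_1+\cdots+m_{k-1}}{m_1,\ldots,m_{k-1}}}\,[u^{m_{k-1}}]\sum_{w\in\mathcal P(\mathcal M_{k-2})}\ \prod_{t=0}^{m_{k-2}}\frac{1}{\big(1-u\,q^{S_t(w)}\big)^{1+\sum_{l=1}^{k-3}\pi^\star_{k-2,l}(w)(t)}},$$ where $[u^{m}]$ denotes the coefficient of $u^m$ in a formal power series in $u$, and $\mathcal P(\mathcal M_{k-2})$ is built from the counts $m_1,\dots,m_{k-2}$.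
   Context: Fix $\lambda>0$. Let $\mathcal P_\lambda$ be a homogeneous Poisson point process of intensity $\lambda$ on $[0,1]$. Set $V=\mathcal P_\lambda\cup\{0,1\}$ and let $G$ be the graph on $V$ in which distinct $x,y$ are adjacent iff $|x-y|<r_0$. A $k$-hop path from $0$ to $1$ is a sequence of vertices $0=v_0,v_1,\dots,v_k=1$ of $G$ with $v_{i-1}$ adjacent to $v_i$ for all $i$. $\sigma_k$ denotes the number of such paths. For $j=1,\dots,k-1$, the lens is $L_j=(1-(k-j)r_0,\; j r_0)$. Under $\frac1k<r_0<\frac1{k-1}$ these are pairwise disjoint intervals of length $kr_0-1>0$. Set $m_j=\#(\mathcal P_\lambda\cap L_j)$. Words / lattice paths: for nonnegative integers $m_1,\dots,m_d$, $\mathcal P(\mathcal M_d)$ is the set of words of length $m_1+\dots+m_d$ in letters $e_1,\dots,e_d$ containing exactly $m_i$ copies of $e_i$. Equivalently, these are lattice paths with unit steps $e_i$ from $\mathbf 0$ to $(m_1,\dots,m_d)$. For a word $w$ and $i\neq j$, write $\pi_{i,j}(w)(s)$, $s=1,\dots,m_j$, for the number of occurrences of $e_i$ in $w$ preceding the $s$-th occurrence of $e_j$. Its multiplicity function is $\pi^\star_{i,j}(w)(r)=\#\{s:\pi_{i,j}(w)(s)=r\}$ for $r=0,\dots,m_i$. For $w\in\mathcal P(\mathcal M_d)$ and $t=0,\dots,m_d$, $S_t(w)$ is the number of $d$-tuples of positions $p_1<\dots<p_d$ in $w$ such that the letter at $p_i$ is $e_i$ for each $i$, and $p_d$ is at or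 before the $t$-th occurrence of $e_d$. So $S_0=0$, and for $d=1$, $S_t=t$. The multinomial coefficient is $\binom{m_1+\cdots+m_{k-1}}{m_1,\ldots,m_{k-1}}=\frac{(m_1+\dots+m_{k-1})!}{m_1!\cdots m_{k-1}!}$. *)

(* Defs.v *)
From mathcomp Require Import all_boot all_order all_algebra.
From mathcomp Require Import all_classical all_reals all_analysis.
Set Implicit Arguments. Unset Strict Implicit. Unset Printing Implicit Defensive.
Import Order.TTheory GRing.Theory Num.Theory.
Local Open Scope ring_scope.

Section Defs.
Variable R : realType.

(* A realization is a finite list of points; N ~ Poisson(lam) and given N = n
   the points are i.i.d. uniform on [0,1].  The integral over [0,1]^n is the
   iterated Lebesgue integral. *)
Fixpoint cube_int (n : nat) (F : seq R -> R) : R :=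
  match n with
  | 0 => F [::]
  | n'.+1 => Rintegral (@lebesgue_measure R) `[0%R, 1%R]%classic
               (fun x => cube_int n' (fun xs => F (x :: xs)))
  end.

Definition ppp_expect (lam : R) (F : seq R -> R) : R :=
  limn (fun N => \sum_(0 <= n < N) (expR (- lam) * lam ^+ n / (n`!)%:R * cube_int n F)).

Definition ppp_cond_expect (lam : R) (F : seq R -> R) (A : seq R -> bool) : R :=
  ppp_expect lam (fun xs => F xs * (A xs)%:R) / ppp_expect lam (fun xs => (A xs)%:R).

Definition vertices (xs : seq R) : seq R := undup (0 :: 1 :: xs).

Definition adj (r0 x y : R) : bool := (x != y) && (`|x - y| < r0).

Definition sigma (k : nat) (r0 : R) (xs : seq R) : nat :=
  let V := vertices xs in
  let v (f : {ffun 'I_k.+1 -> 'I_(size V)}) (i : 'I_k.+1) := nth 0 V (f i) in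
  #|[set f : {ffun 'I_k.+1 -> 'I_(size V)} |
       (v f ord0 == 0) && (v f ord_max == 1) &&
       [forall i : 'I_k.+1, (i < k)%N ==> adj r0 (v f i) (v f (inord i.+1))]]|.

Definition in_lens (k : nat) (r0 : R) (j : nat) (x : R) : bool :=
  (1 - (k - j)%:R * r0 < x) && (x < j%:R * r0).

Definition mcount (k : nat) (r0 : R) (xs : seq R) (j : nat) : nat :=
  count (in_lens k r0 j) (undup xs).

Definition lens_event (k : nat) (r0 : R) (M : nat -> nat) (xs : seq R) : bool :=
  all (fun j => mcount k r0 xs j == M j) (iota 1 k.-1).

Definition fps := nat -> R.
Definition fps_zero : fps := fun _ => 0.
Definition fps_one : fps := fun n => (n == 0%N)%:R.
Definition fps_add (f g : fps) : fps := fun n => f n + g n.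
Definition fps_mul (f g : fps) : fps :=
  fun n => \sum_(i < n.+1) f i * g (n - i)%N.
Definition fps_pow (f : fps) (e : nat) : fps := iter e (fps_mul f) fps_one.
Fixpoint fps_inv_seq (f : fps) (n : nat) : seq R :=
  match n with
  | 0 => [:: (f 0%N)^-1]
  | n'.+1 => let s := fps_inv_seq f n' in
      rcons s (- (f 0%N)^-1 * \sum_(1 <= i < n'.+2) f i * nth 0 s (n'.+1 - i))
  end.
Definition fps_inv (f : fps) : fps := fun n => nth 0 (fps_inv_seq f n) n.
Definition one_minus_u (a : R) : fps :=
  fun n => if n == 0%N then 1 else if n == 1%N then - a else 0.
Definition coef_u (m : nat) (f : fps) : R := f m.

End Defs.

(* words over letters e_1..e_d are represented as seq nat with letters 1..d *)

(* position (0-based) of the s-th (s >= 1) occurrence of letter j in w *)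
Definition occ (w : seq nat) (j s : nat) : nat :=
  nth 0 [seq p <- iota 0 (size w) | nth 0 w p == j] s.-1.

Definition piw (w : seq nat) (i j s : nat) : nat := count_mem i (take (occ w j s) w).

Definition pistar (w : seq nat) (i j r : nat) : nat :=
  count (fun s => piw w i j s == r) (iota 1 (count_mem j w)).

Definition Sw (d : nat) (w : seq nat) (t : nat) : nat :=
  #|[set p : {ffun 'I_d -> 'I_(size w)} |
      [forall a : 'I_d, nth 0 w (p a) == a.+1] &&
      [forall a : 'I_d, forall b : 'I_d, (a < b)%N ==> (p a < p b)%N] &&
      (0 < t)%N &&
      [forall a : 'I_d, (a.+1 == d) ==> (p a <= occ w d t)%N]]|.

(* P(M_d): words of length m_1+...+m_d with exactly m_i copies of e_i;
   a tuple over 'I_d, letter i : 'I_d standing for e_(i+1) *)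
Definition words (d : nat) (M : nat -> nat) :=
  [set w : (\sum_(1 <= i < d.+1) M i).-tuple 'I_d |
     [forall i : 'I_d, count_mem i w == M i.+1]].

Definition word_letters (d : nat) (n : nat) (w : n.-tuple 'I_d) : seq nat :=
  [seq (val i).+1 | i <- w].

Section RHS.
Variable R : realType.

Definition multinom (k : nat) (M : nat -> nat) : R :=
  ((\sum_(1 <= j < k) M j)`!)%:R / (\prod_(1 <= j < k) (M j)`!)%:R.

Definition rhs22 (k : nat) (q : R) (M : nat -> nat) : R :=
  let d := (k - 2)%N in
  (multinom k M)^-1 *
  coef_u (M k.-1)
    (\big[@fps_add R/@fps_zero R]_(w in words d M)
       \big[@fps_mul R/@fps_one R]_(0 <= t < (M d).+1)
          fps_inv (fps_pow (one_minus_u (q ^+ Sw d (word_letters w) t))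
                     (1 + \sum_(1 <= l < d) pistar (word_letters w) d l t)%N)).
End RHS.

(* Main.v *)
(* Shifted to its left end, every lens is the interval (0, k r0 - 1), and points of
   consecutive lenses are adjacent exactly when their offsets decrease.  Hence sigma_k
   counts the occurrences of e_1 ... e_{k-1} as a subsequence of the word that lists the
   labels of the lens points by decreasing offset.  Summed over all labellings of given
   distinct offsets, a function of that word becomes a constant, the sum over all words;
   so E[q^sigma_k; m_1, ..., m_{k-1}] is the sum of q^(number of occurrences) over words,
   times a factor independent of q.  Inserting the letters e_{k-1} into the gaps of a word
   in the other letters turns that sum into the product of geometric series. *)
From HB Require Import structures.
Require Import Defs.
From mathcomp Require Import all_boot all_order all_algebra.
From mathcomp Require Import all_classical all_reals all_analysis.
From mathcomp Require Import measurable_realfun.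
From mathcomp Require Import zify ring lra.
Set Implicit Arguments. Unset Strict Implicit. Unset Printing Implicit Defensive.
Import Order.TTheory GRing.Theory Num.Theory numFieldNormedType.Exports.
Local Open Scope ring_scope.

(** * Iterated sums over sequences *)

(** The lenses come from the two ends of a path: after $j$ hops from 0 a vertex lies below $j r_0$,
    and with $k-j$ hops left before 1 it lies above $1-(k-j)r_0$. So the slack $k r_0 - 1$ is the
    length of every lens. The integrand of a single labelling of the offsets is not constant. Only
    the sum over labellings is, and only off ties, so this sum is taken inside the integral before
    anything is evaluated. The price is measurability: [cube_int] is an iterated integral of
    functions of lists, and each exchange of a sum with an integral needs the inner integrals to be
    measurable in the coordinates still free. Coinciding points are dealt with twice. The
    combinatorial identities carry [undup] and hold for every list; ties are discarded as null sets
    only when the integral is evaluated. Letters are stored by increasing offset, that is, as the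
    reversed word, so that structural recursion on lists removes the last letter. Conditioning is a
    ratio of two expectations: the denominator is the case $q=1$, where the sum over words becomes
    the multinomial coefficient. *)

Section SeqSum.
Variables (A : nmodType) (U : Type).

Fixpoint seqsum (n : nat) (V : seq U) (f : seq U -> A) : A :=
  if n is n'.+1 then \sum_(x <- V) seqsum n' V (fun s => f (x :: s)) else f [::].

Lemma eq_seqsum n V (f g : seq U -> A) : f =1 g -> seqsum n V f = seqsum n V g.
Proof.
elim: n f g => [|n IH] f g fg /=; first exact: fg.
by apply: eq_bigr => x _; apply: IH => s.
Qed.

Lemma seqsum0 n V : seqsum n V (fun=> 0) = 0.
Proof. by elim: n => //= n ->; rewrite big1. Qed.

Lemma seqsumD n V (f g : seq U -> A) :
  seqsum n V (fun s => f s + g s) = seqsum n V f + seqsum n V g.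
Proof.
elim: n f g => [|n IH] f g //=; rewrite -big_split /=.
by apply: eq_bigr => x _; exact: IH.
Qed.

Lemma seqsum_rcons n V (f : seq U -> A) :
  seqsum n.+1 V f = \sum_(x <- V) seqsum n V (fun s => f (rcons s x)).
Proof.
elim: n f => [|n IH] f //.
transitivity (\sum_(y <- V) seqsum n.+1 V (fun s => f (y :: s))); first by [].
under eq_bigr do rewrite IH.
by rewrite exchange_big.
Qed.

Lemma seqsum_rev n V (f : seq U -> A) :
  seqsum n V f = seqsum n V (fun s => f (rev s)).
Proof.
elim: n f => [|n IH] f //; rewrite seqsum_rcons /=; apply: eq_bigr => x _.
by rewrite IH; apply: eq_seqsum => s; rewrite rev_cons.
Qed.

End SeqSum.

Lemma eq_in_seqsum (A : nmodType) (U : eqType) n (V : seq U) (f g : seq U -> A) :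
  (forall s, size s = n -> all (mem V) s -> f s = g s) -> seqsum n V f = seqsum n V g.
Proof.
elim: n f g => [|n IH] f g fg /=; first exact: fg.
rewrite big_seq [RHS]big_seq; apply: eq_bigr => x xV.
by apply: IH => s sz sV; apply: fg; rewrite /= ?sz// xV.
Qed.

Lemma seqsum_map (A : nmodType) U1 U2 (h : U1 -> U2) n V (f : seq U2 -> A) :
  seqsum n (map h V) f = seqsum n V (fun s => f (map h s)).
Proof.
elim: n f => [|n IH] f //=; rewrite big_map; apply: eq_bigr => x _; exact: IH.
Qed.

Lemma seqsum_mulr (A : pzSemiRingType) U n (V : seq U) (f : seq U -> A) c :
  seqsum n V f * c = seqsum n V (fun s => f s * c).
Proof.
elim: n f => [|n IH] f //=; rewrite mulr_suml; apply: eq_bigr => x _; exact: IH.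
Qed.

Lemma sum_tuple_seqsum (A : nmodType) (T : finType) n (f : seq T -> A) :
  \sum_(t : n.-tuple T) f t = seqsum n (enum T) f.
Proof.
elim: n f => [|n IH] f /=.
  by rewrite (big_pred1 [tuple]) // => t; apply/esym/eqP; exact: tuple0.
rewrite big_enum /=.
under [RHS]eq_bigr do rewrite -(IH (fun s => f (_ :: s))).
rewrite pair_bigA /=.
rewrite (reindex (fun p : T * n.-tuple T => [tuple of p.1 :: p.2])) /=; last first.
  exists (fun t => (thead t, [tuple of behead t])) => [[x t] _|t _] /=.
    by congr pair; apply: val_inj.
  by rewrite [in RHS](tuple_eta t); apply: val_inj.
by apply: eq_bigr => -[x t].
Qed.

Lemma sum_ffun_seqsum (A : nmodType) (T : finType) n (f : seq T -> A) :
  \sum_(g : {ffun 'I_n -> T}) f [seq g i | i <- enum 'I_n] = seqsum n (enum T) f.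
Proof.
rewrite -sum_tuple_seqsum (reindex (fun t : n.-tuple T => [ffun i => tnth t i])) /=.
  apply: eq_bigr => t _; congr f; rewrite -[RHS]map_tnth_enum.
  by apply: eq_map => i; rewrite ffunE.
exists (fun g : {ffun 'I_n -> T} => mktuple g) => [t _|g _].
  by apply: eq_from_tnth => i; rewrite tnth_mktuple ffunE.
by apply/ffunP => i; rewrite ffunE tnth_mktuple.
Qed.

Lemma card_ffun_seqsum (U : eqType) n (V : seq U) x0 (P : pred (seq U)) :
  #|[set g : {ffun 'I_n -> 'I_(size V)} |
      P [seq nth x0 V (g i) | i <- enum 'I_n]]| = seqsum n V (fun s => P s : nat).
Proof.
have E : [seq nth x0 V (i : 'I_(size V)) | i <- enum 'I_(size V)] = V.
  by rewrite -[RHS](mkseq_nth x0) /mkseq -val_enum_ord -map_comp.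
transitivity (seqsum n [seq nth x0 V (i : 'I_(size V)) | i <- enum 'I_(size V)]
                (fun s => P s : nat)); last by rewrite E.
rewrite seqsum_map -sum_ffun_seqsum cardsE -sum1_card big_mkcond /=.
apply: eq_bigr => g _; rewrite -[X in if X then _ else _]/(P _) -map_comp /comp.
by case: (P _).
Qed.

(* Words are handled in reverse: [embed j r] counts the occurrences of 1..j as a
   subsequence of [rev r], so that peeling the head of [r] removes the last letter. *)
Fixpoint embed (j : nat) (r : seq nat) {struct r} : nat :=
  match j, r with
  | 0, _ => 1
  | _.+1, [::] => 0
  | j'.+1, x :: r' => embed j r' + (x == j) * embed j' r'
  end.

Arguments embed : simpl never.

Lemma embed0 r : embed 0 r = 1%N. Proof. by case: r. Qed.

Lemma embedS j x r :
  embed j.+1 (x :: r) = (embed j.+1 r + (x == j.+1) * embed j r)%N.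
Proof. by []. Qed.

Lemma embed_cons_neq j x r : (0 < j)%N -> x != j -> embed j (x :: r) = embed j r.
Proof. by case: j => // j _ /negbTE xj; rewrite embedS xj addn0. Qed.

Lemma embed_filter j d r : (j < d)%N ->
  embed j [seq x <- r | x != d] = embed j r.
Proof.
elim: r j => [|x r IH] [|j] // jd; rewrite ?embed0 // embedS /=.
have [->|xd] /= := eqVneq x d; first by rewrite IH // (gtn_eqF jd) addn0.
by rewrite embedS !IH // ltnW.
Qed.

Lemma embed_notin j r : (0 < j)%N -> j \notin r -> embed j r = 0%N.
Proof.
case: j => // j _; elim: r => [|x r IH] //; rewrite inE negb_or eq_sym => /andP[xj jr].
by rewrite embedS IH // (negbTE xj).
Qed.

(** * Inserting a new largest letter into words *)

Section InsertLetter.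
Variables (R : comPzRingType) (g : seq nat -> R) (d : nat).

(* Weight of a reversed word over [1..d+1]: each letter [d.+1] contributes [g] of
   the reversed prefix, over [1..d], that it follows. *)
Fixpoint wt (r : seq nat) : R :=
  if r is x :: r' then
    if x == d.+1 then wt r' * g [seq y <- r' | y != d.+1] else wt r'
  else 1.

(* [insw m r] is the total weight of the words obtained by inserting [m] letters
   [d.+1] in [r]. *)
Fixpoint insw (m : nat) (r : seq nat) {struct r} : R :=
  if r is x :: r' then
    (fix aux m := if m is m'.+1 then insw m r' + aux m' * g r else 1) m
  else g [::] ^+ m.

Lemma insw0 r : insw 0 r = 1. Proof. by case: r. Qed.

(** The head of the new word is either [x] or an inserted letter of weight [g (x :: r)]. For the
    series $F_r(u)$ with coefficients [insw m r] this reads $(1 - u\,g(x::r))\,F_{x::r} = F_r$. *)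
Lemma inswS m x r : insw m.+1 (x :: r) = insw m.+1 r + insw m (x :: r) * g (x :: r).
Proof. by []. Qed.

(** A word with [m] letters [d.+1] is a word over [1..d] with [m] insertions. Removing the head
    works by induction because [phi] is arbitrary: a head [d.+1] turns [phi] into [phi * g], and a
    head [x] is absorbed by [phi (x :: r)]. *)
Lemma sum_wt n m (phi : seq nat -> R) :
  seqsum (n + m) (iota 1 d.+1)
    (fun r => (count_mem d.+1 r == m)%:R * phi [seq x <- r | x != d.+1] * wt r)
  = seqsum n (iota 1 d) (fun r => phi r * insw m r).
Proof.
have big_last (A : nmodType) (f : nat -> A) :
    \sum_(x <- iota 1 d.+1) f x = \sum_(x <- iota 1 d) f x + f d.+1.
  have -> : iota 1 d.+1 = iota 1 d ++ [:: d.+1] by rewrite -(addn1 d) iotaD addnC.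
  by rewrite big_cat /= big_seq1.
have low x : x \in iota 1 d -> (x == d.+1) = false.
  by rewrite mem_iota; lia.
elim: n m phi => [|n IHn] m phi.
  rewrite add0n /=; elim: m phi => [|m IHm] phi /=; first by rewrite !mul1r.
  rewrite big_last /= eqxx /= [X in X + _]big_seq big1 ?add0r => [|x xd].
    have := IHm (fun r => phi r * g r); rewrite exprSr mulrA -[RHS]mulrAC => <-.
    apply: eq_seqsum => s; rewrite eqSS; ring.
  rewrite low //= -[RHS](seqsum0 _ m (iota 1 d.+1)).
  apply: eq_in_seqsum => s <- _; rewrite add0n.
  by rewrite ltn_eqF ?mul0r // ltnS count_size.
elim: m phi => [|m IHm] phi.
  rewrite addSn /= big_last [X in _ + X](_ : _ = 0) ?addr0; last first.
    rewrite -[RHS](seqsum0 _ (n + 0) (iota 1 d.+1)); apply: eq_seqsum => s.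
    by rewrite eqxx !mul0r.
  rewrite big_seq [RHS]big_seq; apply: eq_bigr => x xd.
  rewrite low //=; have := IHn 0%N (fun r => phi (x :: r)).
  under [in RHS]eq_seqsum do rewrite insw0.
  by move=> <-; apply: eq_seqsum.
rewrite addSn [LHS]/= big_last eqxx /=.
have := IHm (fun r => phi r * g r); rewrite addSnnS => IHm'.
rewrite (eq_seqsum _ _ (g := fun r => (count_mem d.+1 r == m)%:R *
    (phi [seq x <- r | x != d.+1] * g [seq x <- r | x != d.+1]) * wt r)); last first.
  by move=> s; rewrite eqSS; ring.
rewrite IHm' /= -big_split big_seq [RHS]big_seq; apply: eq_bigr => x xd /=.
have /= := IHn m.+1 (fun r => phi (x :: r)).
rewrite -[X in (n + X.+1)%N]/m -addSnnS => IHn'.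
under [in RHS]eq_seqsum do rewrite -[X in _ * X]/(_ + _) mulrDr.
rewrite seqsumD -IHn'; congr (_ + _).
  by apply: eq_seqsum => s; rewrite low.
by apply: eq_seqsum => s; rewrite -mulrA [g _ * _]mulrC.
Qed.
End InsertLetter.

(** * Counting words and formal power series *)

Definition has_counts (d : nat) (M : nat -> nat) (c : seq nat) : bool :=
  all (fun j => count_mem j c == M j) (iota 1 d).

Lemma has_countsS d M c : has_counts d.+1 M c =
  (count_mem d.+1 c == M d.+1) && has_counts d M [seq x <- c | x != d.+1].
Proof.
rewrite /has_counts; have -> : iota 1 d.+1 = iota 1 d ++ [:: d.+1].
  by rewrite -(addn1 d) iotaD addnC.
rewrite all_cat /= andbT andbC; congr (_ && _); apply: eq_in_all => j.
rewrite mem_iota => jd; rewrite count_filter; congr (_ == _).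
by apply: eq_count => x /=; case: eqVneq => //= ->; lia.
Qed.

Section InsertionSums.
Variable R : realType.

(** Each letter [d.+1] completes exactly the occurrences of $1 \ldots d$ found before it. *)
Lemma wt_embed (q : R) d r : wt (fun r => q ^+ embed d r) d r = q ^+ embed d.+1 r.
Proof.
elim: r => [|x r IH] /=; first by rewrite expr0.
rewrite embedS; case: eqP => _; rewrite IH ?addn0 //.
by rewrite embed_filter // mul1n exprD.
Qed.

Lemma wt1 d r : wt (fun=> 1) d r = 1 :> R.
Proof. by elim: r => //= x r ->; rewrite mulr1 if_same. Qed.

(** Stars and bars: [m] equal letters go into [size r + 1] gaps. *)
Lemma insw1 m r : insw (fun=> 1) m r = 'C(size r + m, m)%:R :> R.
Proof.
elim: r m => [|x r IH] m; first by rewrite /= expr1n add0n binn.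
elim: m => [|m IHm]; first by rewrite insw0 bin0.
by rewrite inswS IHm IH mulr1 -natrD /= addSnnS addSn binS.
Qed.

Lemma sum_words_insert (q : R) d M :
  seqsum (\sum_(1 <= i < d.+2) M i) (iota 1 d.+1)
    (fun c => (has_counts d.+1 M c)%:R * q ^+ embed d.+1 c)
  = seqsum (\sum_(1 <= i < d.+1) M i) (iota 1 d)
    (fun c => (has_counts d M c)%:R * insw (fun r => q ^+ embed d r) (M d.+1) c).
Proof.
rewrite big_nat_recr //= -sum_wt; apply: eq_seqsum => s.
by rewrite wt_embed has_countsS -mulnb natrM.
Qed.

(** With weight 1 the insertion identity merely counts; the binomials of the successive letters
    multiply to the multinomial. *)
Lemma sum_words_multinom d M :
  seqsum (\sum_(1 <= i < d.+1) M i) (iota 1 d) (fun c => (has_counts d M c)%:R)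
  = multinom R d.+1 M.
Proof.
rewrite /multinom; elim: d => [|d IH]; first by rewrite !big_geq //= divr1.
rewrite !(big_nat_recr d.+1) //=; set n := (\sum_(1 <= i < d.+1) M i)%N.
have := sum_wt (fun=> 1 : R) d n (M d.+1) (fun c => (has_counts d M c)%:R).
under eq_seqsum => s do rewrite wt1 mulr1 -natrM mulnb -has_countsS.
move=> ->.
rewrite (@eq_in_seqsum _ _ _ _ _
    (fun r => (has_counts d M r)%:R * 'C(n + M d.+1, M d.+1)%:R)); last first.
  by move=> s <- _; rewrite insw1.
rewrite -seqsum_mulr IH -/n -(@bin_fact (n + M d.+1) (M d.+1)) ?leq_addl // addnK.
rewrite !natrM; field; rewrite !pnatr_eq0 -!lt0n fact_gt0 /=.
by rewrite prodn_gt0 // => i; exact: fact_gt0.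
Qed.

End InsertionSums.

Section FormalPowerSeries.
Variable R : realType.
Implicit Types f g h : fps R.

(** A coefficient of a product depends only on truncations, so the laws of the Cauchy product are
    inherited from polynomials. *)
Let trunc f n : {poly R} := \poly_(i < n.+1) f i.

Lemma coef_fps_mul f g n m : (m <= n)%N ->
  fps_mul f g m = (trunc f n * trunc g n)`_m.
Proof.
move=> mn; rewrite coefM; apply: eq_bigr => i _.
have im := ltn_ord i; rewrite !coef_poly !ifT //; lia.
Qed.

Lemma fps_mulC : commutative (@fps_mul R).
Proof. by move=> f g; apply/funext => n; rewrite !(coef_fps_mul _ _ (leqnn n)) mulrC. Qed.

Lemma fps_mulA : associative (@fps_mul R).
Proof.
move=> f g h; apply/funext => n.
transitivity ((trunc f n * (trunc g n * trunc h n))`_n).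
  rewrite [RHS]coefM; apply: eq_bigr => i _; have im := ltn_ord i.
  by rewrite -coef_fps_mul ?leq_subr // coef_poly im.
rewrite mulrA [LHS]coefM; apply: eq_bigr => i _; have im := ltn_ord i.
by rewrite -coef_fps_mul // coef_poly ifT // ltnS leq_subr.
Qed.

Lemma fps_mul1 : left_id (@fps_one R) (@fps_mul R).
Proof.
move=> f; apply/funext => n; rewrite /fps_mul big_ord_recl /= mul1r subn0.
by rewrite big1 ?addr0 // => i _; rewrite mul0r.
Qed.

HB.instance Definition _ :=
  Monoid.isComLaw.Build (fps R) (@fps_one R) (@fps_mul R) fps_mulA fps_mulC fps_mul1.

Lemma size_fps_inv_seq f n : size (fps_inv_seq f n) = n.+1.
Proof. by elim: n => //= n IH; rewrite size_rcons IH. Qed.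

Lemma nth_fps_inv_seq f n i : (i <= n)%N -> nth 0 (fps_inv_seq f n) i = fps_inv f i.
Proof.
elim: n i => [|n IH] i; first by rewrite leqn0 => /eqP ->.
rewrite leq_eqVlt => /predU1P[-> //|i_n] /=.
by rewrite nth_rcons size_fps_inv_seq i_n IH.
Qed.

Lemma fps_mulV f : f 0%N != 0 -> fps_mul f (fps_inv f) = @fps_one R.
Proof.
move=> f0; apply/funext => -[|n]; rewrite /fps_mul.
  by rewrite big_ord_recl big_ord0 addr0 divff.
rewrite big_ord_recl subn0.
rewrite {1}/fps_inv /= nth_rcons size_fps_inv_seq ltnn eqxx.
rewrite big_add1 big_mkord /= mulrA mulrN divff // mulN1r.
rewrite [X in - X](_ : _ = \sum_(i < n.+1) f (bump 0 i) * fps_inv f (n.+1 - bump 0 i)%N).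
  by rewrite addNr.
by apply: eq_bigr => i _; rewrite nth_fps_inv_seq // subSS leq_subr.
Qed.

Lemma fps_inv_uniq f g : f 0%N != 0 -> fps_mul f g = @fps_one R -> g = fps_inv f.
Proof.
move=> f0 fg; rewrite -[LHS](fps_mul1 g) -(fps_mulV f0) [fps_mul f _]fps_mulC.
by rewrite -fps_mulA fg fps_mulC fps_mul1.
Qed.

Lemma fps_mul_coef0 f g : fps_mul f g 0%N = f 0%N * g 0%N.
Proof. by rewrite /fps_mul big_ord_recl big_ord0 addr0. Qed.

Lemma fps_inv_pow f e : f 0%N = 1 -> fps_inv (fps_pow f e) = fps_pow (fps_inv f) e.
Proof.
move=> f1; have pow1 : fps_pow f e 0%N = 1.
  by elim: e => //= e IH; rewrite fps_mul_coef0 IH f1 mul1r.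
apply/esym/fps_inv_uniq; first by rewrite pow1 oner_eq0.
rewrite {pow1}; elim: e => [|e IH] /=; first exact: fps_mul1.
rewrite [fps_mul (fps_inv f) _]fps_mulC fps_mulA -[X in fps_mul X _]fps_mulA IH.
by rewrite [fps_mul f _]fps_mulC fps_mul1 fps_mulV // f1 oner_eq0.
Qed.

Lemma fps_mul_one_minus_u a f m :
  fps_mul (one_minus_u a) f m = f m - a * (if m is m'.+1 then f m' else 0).
Proof.
rewrite /fps_mul big_ord_recl subn0 {1}/one_minus_u /= mul1r; congr (_ + _).
case: m => [|m]; first by rewrite big_ord0 mulr0 oppr0.
rewrite big_ord_recl big1 => [|i _]; first by rewrite /one_minus_u /= subSS subn0 addr0 mulNr.
by rewrite /one_minus_u /= mul0r.
Qed.

Lemma insw_cons_fps (g : seq nat -> R) x r : (insw g)^~ (x :: r) =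
  fps_mul (fps_inv (one_minus_u (g (x :: r)))) ((insw g)^~ r).
Proof.
have <- : fps_mul (one_minus_u (g (x :: r))) ((insw g)^~ (x :: r)) = (insw g)^~ r.
  apply/funext => -[|m]; rewrite fps_mul_one_minus_u ?insw0 ?mulr0 ?subr0 //.
  by rewrite inswS mulrC addrK.
by rewrite fps_mulA [fps_mul (fps_inv _) _]fps_mulC fps_mulV ?fps_mul1 //= oner_eq0.
Qed.

Lemma insw_nil_fps (g : seq nat -> R) :
  (insw g)^~ [::] = fps_inv (one_minus_u (g [::])).
Proof.
apply: fps_inv_uniq; first by rewrite /= oner_eq0.
apply/funext => -[|m]; rewrite fps_mul_one_minus_u ?mulr0 ?subr0 //=.
by rewrite exprS subrr.
Qed.

(** One geometric series per gap: the letters put after the first [i] letters of [v] all weigh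
    [g (rev (take i v))]. *)
Lemma insw_fps (g : seq nat -> R) v : (insw g)^~ (rev v) =
  \big[@fps_mul R/@fps_one R]_(i < (size v).+1)
     fps_inv (one_minus_u (g (rev (take i v)))).
Proof.
elim/last_ind: v => [|v x IH].
  by rewrite big_ord_recl big_ord0 insw_nil_fps fps_mulC fps_mul1.
rewrite rev_rcons insw_cons_fps size_rcons big_ord_recr /= fps_mulC IH.
rewrite -[X in take X _](size_rcons v x) take_size rev_rcons; congr fps_mul.
by apply: eq_bigr => i _; rewrite -cats1 takel_cat // -ltnS.
Qed.

Lemma fps_sum_coef I (s : seq I) P (F : I -> fps R) m :
  (\big[@fps_add R/@fps_zero R]_(i <- s | P i) F i) m = \sum_(i <- s | P i) F i m.
Proof. exact: (big_morph (fun f : fps R => f m)). Qed.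

Lemma fps_big_const (I : finType) (P : pred I) f :
  \big[@fps_mul R/@fps_one R]_(i | P i) f = fps_pow f #|P|.
Proof. by rewrite big_const. Qed.

End FormalPowerSeries.

(** * The gaps of a word *)

(** The list that [occ] indexes, named to give it a recursion on the word. *)
Definition positions (v : seq nat) (l : nat) : seq nat :=
  [seq p <- iota 0 (size v) | nth 0 v p == l].

Lemma positions_cons x v l : positions (x :: v) l =
  (if x == l then cons 0 else id) [seq p.+1 | p <- positions v l].
Proof.
rewrite /positions /= (iotaDl 1 0) filter_map.
by case: (x == l).
Qed.

Lemma size_positions v l : size (positions v l) = count_mem l v.
Proof.
elim: v => //= x v IH; rewrite positions_cons.
by case: (x == l); rewrite /= size_map IH.
Qed.

Lemma count_take_occ (v : seq nat) (l t : nat) : (0 < t <= count_mem l v)%N ->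
  count_mem l (take (occ v l t).+1 v) = t.
Proof.
rewrite /occ -/(positions v l).
elim: v t => [|x v IH] t /=; first by lia.
rewrite positions_cons; case: (x == l) => /= tv.
  case: t tv => [|[|t]] //= tv; first by rewrite take0.
  have tp : (t < size (positions v l))%N by rewrite size_positions.
  by rewrite (nth_map 0%N) // (IH t.+1) // -size_positions.
case: t tv => // t tv.
by rewrite (nth_map 0%N) ?size_positions // (IH t.+1).
Qed.

Lemma occ_lt_size (v : seq nat) (l t : nat) : (0 < t <= count_mem l v)%N -> (occ v l t < size v)%N.
Proof.
move=> tv; have : occ v l t \in positions v l.
  by rewrite mem_nth // size_positions; case: t tv.
by rewrite mem_filter mem_iota => /andP[].
Qed.

Lemma pistarE v d l t : pistar v d l t =
  (\sum_(p < size v) ((nth 0 v p == l) && (count_mem d (take p v) == t)))%N.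
Proof.
rewrite /pistar -size_positions.
have -> : iota 1 (size (positions v l)) = map S (iota 0 (size (positions v l))).
  by rewrite -(iotaDl 1 0).
rewrite count_map.
transitivity (count (fun p => count_mem d (take p v) == t) (positions v l)).
  rewrite -[in RHS](mkseq_nth 0%N (positions v l)) /mkseq count_map.
  by apply: eq_count.
rewrite count_filter -sum1_count big_mkcond /= -(big_mkord xpredT
  (fun p => ((nth 0 v p == l) && (count_mem d (take p v) == t) : nat))).
rewrite /index_iota subn0; apply: eq_bigr => p _.
by rewrite andbC; case: (_ && _).
Qed.

(** The gaps preceded by exactly [t] letters [d] form a block. It stops at the next [d] or, if [t]
    is the total, at the end of the word; this one gap is the 1 in the exponent. *)
Lemma one_gap_before_letter (v : seq nat) (d t : nat) : (t <= count_mem d v)%N ->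
  (\sum_(p < size v) ((nth 0 v p == d) && (count_mem d (take p v) == t))
     + (count_mem d v == t))%N = 1%N.
Proof.
elim: v t => [|x v IH] t /=; first by rewrite big_ord0 leqn0 => /eqP ->.
rewrite big_ord_recl /=; case: (x == d) => /=.
  case: t => [|t] tv; first by rewrite big1 // => i _; rewrite andbF.
  by rewrite add0n; apply: etrans (IH t tv).
by rewrite !add0n => /IH.
Qed.

(** A gap is identified by what follows it: a letter [l < d], counted by [pistar], or else [d] or
    the end of the word, counted by the 1. *)
Lemma gap_count (v : seq nat) (d t : nat) : all (mem (iota 1 d)) v -> (t <= count_mem d v)%N ->
  (1 + \sum_(1 <= l < d) pistar v d l t)%N =
  #|[pred i : 'I_(size v).+1 | count_mem d (take i v) == t]|.
Proof.
move=> vd tv; set P := (\sum_(1 <= l < d) _)%N.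
rewrite -(one_gap_before_letter tv) {}/P -[RHS]sum1_card [RHS]big_mkcond /=.
rewrite [RHS]big_ord_recr /= !inE /= take_size.
have ifE (b : bool) : (if b then 1 else 0)%N = b :> nat by case: b.
rewrite ifE addnAC; congr (_ + _)%N.
under [X in (_ + X)%N]eq_bigr do rewrite pistarE.
rewrite exchange_big -big_split /=; apply: eq_bigr => i _.
rewrite ifE inE /=; have : nth 0 v i \in iota 1 d by move/allP: vd; apply; rewrite mem_nth.
rewrite mem_iota; move: (nth 0 v i) => x xd.
case: (_ == t); last by rewrite andbF big1 // => l _; rewrite andbF.
rewrite andbT; under eq_bigr do rewrite andbT.
have [->|x_d] := eqVneq x d.
  by rewrite big_nat big1 // => l /andP[_ ld]; rewrite gtn_eqF.
rewrite (bigD1_seq x) ?iota_uniq ?mem_index_iota //=; last by lia.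
by rewrite eqxx big1 // => l /negbTE; rewrite eq_sym => ->.
Qed.

(** The position tuples of [Sw] as lists, with a variable bound [y] so that removing the last
    position leaves a tuple of the same kind. *)
Definition chain_at (v : seq nat) (y : nat) (s : seq nat) : bool :=
  [&& all (fun a => nth 0 v (nth 0 s a) == a.+1) (iota 0 (size s)),
      sorted ltn s & all (fun p => p < y)%N s].

Lemma chain_at_rcons v y s p : chain_at v y (rcons s p) =
  [&& p < y, nth 0 v p == (size s).+1 & chain_at v p s]%N.
Proof.
rewrite /chain_at size_rcons -addn1 iotaD all_cat /= nth_rcons ltnn eqxx andbT.
rewrite (eq_in_all (a2 := fun a => nth 0 v (nth 0 s a) == a.+1)); last first.
  by move=> a; rewrite mem_iota => /andP[_ a_s]; rewrite nth_rcons a_s.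
have -> : sorted ltn (rcons s p) = all (fun a => a < p)%N s && sorted ltn s.
  rewrite -[LHS](rev_sorted (fun a b => (b < a)%N)) rev_rcons /= path_sortedE; last first.
    by move=> a b c /= ba ac; exact: ltn_trans ac ba.
  by rewrite all_rev rev_sorted.
rewrite all_rcons; have [py|_] := ltnP p y; last by rewrite !andbF.
have sub : all (fun a => a < p)%N s -> all (fun a => a < y)%N s.
  by apply: sub_all => a /ltn_trans; exact.
case sp : (all (fun a => a < p)%N s); rewrite ?(sub sp) /= ?andbF //.
by rewrite !andbT add0n addn1 -andbA andbCA.
Qed.

Lemma embed_take v j y : (y <= size v)%N -> embed j.+1 (rev (take y v)) =
  (\sum_(0 <= p < y) (nth 0 v p == j.+1) * embed j (rev (take p v)))%N.
Proof.
elim: y => [|y IH] yv; first by rewrite take0 big_geq.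
by rewrite big_nat_recr //= -IH ?(ltnW yv) // (take_nth 0%N) // rev_rcons embedS.
Qed.

Lemma sum_chain_at v j y : (y <= size v)%N ->
  seqsum j (iota 0 (size v)) (fun s => chain_at v y s : nat) =
  embed j (rev (take y v)).
Proof.
elim: j y => [|j IH] y yv; first by rewrite embed0.
rewrite seqsum_rcons embed_take // -{1}[size v]subn0 -/(index_iota 0 (size v)).
rewrite [RHS](big_nat_widen _ _ (size v)) // [RHS]big_mkcond /=.
rewrite big_nat [RHS]big_nat; apply: eq_bigr => p /andP[_ pv].
have [py|yp] := ltnP p y; last first.
  apply: etrans (seqsum0 _ j (iota 0 (size v))); apply: eq_seqsum => s.
  by rewrite chain_at_rcons ltnNge yp.
rewrite -IH 1?ltnW // mulnC.
apply: etrans _ (esym (@seqsum_mulr nat _ _ _ _ _)).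
apply: eq_in_seqsum => s sz _.
by rewrite -[RHS]/(_ * _)%N chain_at_rcons py sz mulnb /= andbC.
Qed.

Lemma card_ffun_ord n N (P : pred (seq nat)) :
  #|[set g : {ffun 'I_n -> 'I_N} | P [seq val (g i) | i <- enum 'I_n]]| =
  seqsum n (iota 0 N) (fun s => P s : nat).
Proof.
rewrite -val_enum_ord seqsum_map -sum_ffun_seqsum cardsE -sum1_card big_mkcond /=.
apply: eq_bigr => g _; rewrite -[X in if X then _ else _]/(P _) -map_comp /comp.
by case: (P _).
Qed.

(** Only a letter [d] changes the count, so all gaps of a block have the same factor. *)
Lemma embed_count_eq (v : seq nat) (d i j : nat) : (0 < d)%N ->
  count_mem d (take i v) = count_mem d (take j v) ->
  embed d (rev (take i v)) = embed d (rev (take j v)).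
Proof.
move=> d0; wlog ij : i j / (i <= j)%N.
  by move=> H; case/orP: (leq_total i j) => ij E; [|apply/esym]; apply: H.
have -> : take j v = take i v ++ take (j - i) (drop i v) by rewrite -takeD subnKC.
rewrite count_cat rev_cat; set w := take (j - i) _ => E.
have : d \notin rev w by rewrite mem_rev -has_pred1 has_count; lia.
elim: (rev w) => //= x r IH; rewrite inE negb_or eq_sym => /andP[xd /IH ->].
by rewrite embed_cons_neq.
Qed.

Lemma Sw_embed (v : seq nat) (d i t : nat) : (0 < d)%N -> count_mem d (take i v) = t ->
  Sw d v t = embed d (rev (take i v)).
Proof.
move=> d0 it; have tv : (t <= count_mem d v)%N.
  by rewrite -it -[in leqRHS](cat_take_drop i v) count_cat leq_addr.
(* At [t = 0] the index [t.-1] would make [occ] return the first occurrence; there [Sw] vanishes by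
   its conjunct [0 < t], and the prefix contains no [d]. *)
have [t0|t0] := posnP t.
  rewrite embed_notin //; last by rewrite mem_rev -has_pred1 has_count it t0.
  by rewrite /Sw t0; apply: eq_card0 => p; rewrite inE /= andbF.
have t_ok : (0 < t <= count_mem d v)%N by rewrite t0.
(* Any prefix with [t] letters [d] will do; take the one ending at the [t]-th of them. *)
rewrite (@embed_count_eq v d i (occ v d t).+1) //; last by rewrite count_take_occ.
rewrite -sum_chain_at; last exact: occ_lt_size.
rewrite -card_ffun_ord /Sw; apply: eq_card => p; rewrite !inE t0 andbT.
set s := map _ _; have sz : size s = d by rewrite size_map size_enum_ord.
have sE (a : 'I_d) : nth 0%N s a = p a.
  by rewrite (nth_map a) ?size_enum_ord // nth_ord_enum.
apply/andP/and3P.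
  case=> /andP[/forallP H1 /forallP H2] /forallP H3.
  have srt : sorted ltn s.
    apply/(sortedP 0%N) => a; rewrite sz => ad.
    have ad' := ltnW ad.
    have /forallP/(_ (Ordinal ad)) := H2 (Ordinal ad').
    by rewrite -!sE /= ltnSn.
  split=> //.
    apply/allP => a; rewrite mem_iota sz add0n => /= ad.
    by have := H1 (Ordinal ad); rewrite -sE.
  (* [Sw] bounds the last position only; the others lie below it because the list increases. *)
  apply/(all_nthP 0%N) => a; rewrite sz ltnS => ad.
  have d1 : (d.-1 < d)%N by rewrite prednK.
  have := H3 (Ordinal d1); rewrite -sE /= prednK // eqxx /=; apply: leq_trans.
  have := sorted_leq_nth leq_trans leqnn 0%N (sub_sorted ltnW srt).
  by apply; rewrite ?inE ?sz //; lia.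
case=> /allP H1 H2 /allP H3; split; last first.
  apply/forallP => a; apply/implyP => _; rewrite -sE -ltnS; apply: H3.
  by rewrite mem_nth // sz.
apply/andP; split; apply/forallP => a.
  by rewrite -sE; apply: H1; rewrite mem_iota sz /=.
apply/forallP => b; apply/implyP => ab; rewrite -!sE.
by apply: (sorted_ltn_nth ltn_trans 0%N H2) => //; rewrite inE sz.
Qed.

Section WordProduct.
Variable R : realType.

(** Group the gaps by the number [t] of letters [d] before them: [Sw_embed] makes the factor
    constant on a block, and [gap_count] gives the size of the block. *)
Lemma prod_gaps (q : R) d M v : (0 < d)%N -> all (mem (iota 1 d)) v ->
  count_mem d v = M d ->
  \big[@fps_mul R/@fps_one R]_(0 <= t < (M d).+1)
     fps_inv (fps_pow (one_minus_u (q ^+ Sw d v t))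
        (1 + \sum_(1 <= l < d) pistar v d l t)%N)
  = (insw (fun r => q ^+ embed d r))^~ (rev v).
Proof.
move=> d0 vd vM; rewrite insw_fps big_mkord.
have cle (i : nat) : (count_mem d (take i v) < (M d).+1)%N.
  by rewrite ltnS -vM -[in leqRHS](cat_take_drop i v) count_cat leq_addr.
rewrite [RHS](partition_big (fun i : 'I_(size v).+1 => Ordinal (cle i)) xpredT) //.
apply: eq_bigr => t _; rewrite fps_inv_pow // gap_count //; last first.
  by rewrite vM -ltnS.
rewrite -fps_big_const; apply: congr_big => // i /eqP it.
by rewrite (Sw_embed d0 it).
Qed.

Lemma sum_words_gaps (q : R) d M : (0 < d)%N ->
  coef_u (M d.+1)
    (\big[@fps_add R/@fps_zero R]_(w in words d M)
       \big[@fps_mul R/@fps_one R]_(0 <= t < (M d).+1)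
          fps_inv (fps_pow (one_minus_u (q ^+ Sw d (word_letters w) t))
                     (1 + \sum_(1 <= l < d) pistar (word_letters w) d l t)%N))
  = seqsum (\sum_(1 <= i < d.+2) M i) (iota 1 d.+1)
    (fun c => (has_counts d.+1 M c)%:R * q ^+ embed d.+1 c).
Proof.
(* [words] are read left to right and [insw] takes them reversed; the sum over all lists is
   invariant under reversal. *)
move=> d0; rewrite /coef_u fps_sum_coef sum_words_insert seqsum_rev.
have -> : iota 1 d = [seq (val i).+1 | i <- enum 'I_d].
  by rewrite (map_comp S) val_enum_ord -(iotaDl 1 0).
rewrite seqsum_map -sum_tuple_seqsum big_mkcond; apply: eq_bigr => w _.
rewrite -/(word_letters w).
have wP : has_counts d M (rev (word_letters w)) = (w \in words d M).
  rewrite inE; apply/allP/forallP => [H i|H j].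
    have iI : i.+1 \in iota 1 d by rewrite mem_iota; have := ltn_ord i; lia.
    have := H _ iI; rewrite count_rev count_map.
    by congr (_ == _); apply: eq_count => x /=; rewrite eqSS.
  rewrite mem_iota; case: j => // j /= jd; have {}jd : (j < d)%N by lia.
  have := H (Ordinal jd).
  by rewrite count_rev count_map; congr (_ == _); apply: eq_count => x.
rewrite wP; case: ifP => wM; last by rewrite mul0r.
rewrite mul1r prod_gaps //.
  apply/allP => x /mapP[i _ ->]; rewrite inE mem_iota /=; have := ltn_ord i; lia.
move: wP; rewrite wM => /allP /(_ d); rewrite mem_iota count_rev => H.
by apply/eqP/H; rewrite d0 /=; lia.
Qed.

End WordProduct.

(** * Measurability and iterated integrals *)

Section IteratedIntegrals.
Variable R : realType.
Local Notation mu := (@lebesgue_measure R).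

(** A class that ensures integrability on every set of finite measure, as linearity of [Rintegral]
    requires. *)
Definition bounded_measurable (g : R -> R) : Prop :=
  measurable_fun setT g /\ exists C, forall x, `|g x| <= C.

Variables (D : set (measurableTypeR R)) (v : R).
Hypotheses (mD : measurable D) (muD : mu D = v%:E).
Local Notation I g := (Rintegral mu D g).

Lemma bm_integrable g : bounded_measurable g -> mu.-integrable D (EFin \o g).
Proof.
case=> mg [C gC]; apply: measurable_bounded_integrable => //.
- by have := ltry v; rewrite -muD.
- exact: measurable_funS mg.
- exists C; split; first exact: num_real.
  by move=> M CM x _ /=; apply: le_trans (gC x) (ltW CM).
Qed.

Lemma bmD g h : bounded_measurable g -> bounded_measurable h ->
  bounded_measurable (fun x => g x + h x).
Proof.
case=> mg [C gC] [mh [E hE]]; split; first exact: measurable_funD.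
by exists (C + E) => x; apply: le_trans (ler_normD _ _) (lerD _ _).
Qed.

Lemma bmM c g : bounded_measurable g -> bounded_measurable (fun x => c * g x).
Proof.
case=> mg [C gC]; split; first exact: measurable_funM.
by exists (`|c| * C) => x; rewrite normrM ler_wpM2l.
Qed.

Lemma bm_cst c : bounded_measurable (fun=> c).
Proof. by split; [exact: measurable_cst | exists `|c|]. Qed.

Lemma bm_sum T (r : seq T) (F : T -> R -> R) :
  (forall i, bounded_measurable (F i)) ->
  bounded_measurable (fun x => \sum_(i <- r) F i x).
Proof.
move=> H; elim: r => [|i r IH].
  by under eq_fun do rewrite big_nil; exact: bm_cst.
by under eq_fun do rewrite big_cons; exact: bmD.
Qed.

Lemma bm_seqsum n T (V : seq T) (F : seq T -> R -> R) :
  (forall s, bounded_measurable (F s)) ->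
  bounded_measurable (fun x => seqsum n V (fun s => F s x)).
Proof.
by elim: n F => [|n IH] F H //=; apply: bm_sum => i; exact: (IH (fun s => F (i :: s))).
Qed.

Lemma I_cst c : I (fun=> c) = c * v.
Proof. by rewrite Rintegral_cst //; congr (c * _); exact: (congr1 fine muD). Qed.

Lemma I_add g h : bounded_measurable g -> bounded_measurable h ->
  I (fun x => g x + h x) = I g + I h.
Proof. by move=> Hg Hh; rewrite RintegralD //; exact: bm_integrable. Qed.

Lemma I_scale c g : bounded_measurable g -> I (fun x => c * g x) = c * I g.
Proof. by move=> Hg; rewrite RintegralZl //; exact: bm_integrable. Qed.

Lemma I_sum T (r : seq T) (F : T -> R -> R) :
  (forall i, bounded_measurable (F i)) ->
  I (fun x => \sum_(i <- r) F i x) = \sum_(i <- r) I (F i).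
Proof.
move=> H; elim: r => [|i r IH].
  rewrite big_nil; under eq_Rintegral do rewrite big_nil; by rewrite I_cst mul0r.
rewrite big_cons -IH; under eq_Rintegral do rewrite big_cons.
by rewrite I_add //; exact: bm_sum.
Qed.

Lemma I_seqsum n T (V : seq T) (F : seq T -> R -> R) :
  (forall s, bounded_measurable (F s)) ->
  I (fun x => seqsum n V (fun s => F s x)) = seqsum n V (fun s => I (F s)).
Proof.
elim: n F => [|n IH] F H //=.
rewrite I_sum => [|i]; last exact: bm_seqsum.
by apply: eq_bigr => i _; exact: (IH (fun s => F (i :: s))).
Qed.

Lemma I_bound g C : bounded_measurable g -> (forall x, `|g x| <= C) ->
  `|I g| <= C * v.
Proof.
move=> Hg gC; rewrite -I_cst; apply: le_trans (le_normr_Rintegral _ _) _ => //.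
  exact: bm_integrable.
apply: le_Rintegral => //; last exact/bm_integrable/bm_cst.
apply: bm_integrable; case: Hg => mg _; split.
  exact: measurableT_comp.
by exists C => x; rewrite normr_id.
Qed.

(** A finite set is null; [s] will hold the coordinates already chosen. *)
Lemma I_ae_cst g c (s : seq R) : bounded_measurable g ->
  (forall x, D x -> x \notin s -> g x = c) -> I g = c * v.
Proof.
move=> [mg _] gc; rewrite -I_cst /Rintegral; congr fine.
apply: ae_eq_integral => //.
- by apply/measurable_EFinP; exact: measurable_funS mg.
- exists [set` s]%classic; split.
  + by apply: countable_measurable => [t|]; [exact: measurable_set1 | exact: (finite_set_countable (finite_seq s))].
  + by apply: countable_lebesgue_measure0; exact: (finite_set_countable (finite_seq s)).
  + move=> x /= xs; apply: contrapT => xns; apply: xs => Dx.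
    by rewrite gc //; apply/negP.
Qed.

Lemma measurable_I_param d (T : measurableType d) (h : T * R -> R) C :
  measurable_fun setT h -> (forall p, `|h p| <= C) ->
  measurable_fun setT (fun t => I (fun x => h (t, x))).
Proof.
move=> mh hC.
(* Tonelli asks for a nonnegative integrand on the whole line: shift by the bound [C], then multiply
   by the indicator of [D]. *)
have E t : I (fun x => h (t, x)) = I (fun x => h (t, x) + C) - C * v.
  rewrite I_add; last exact: bm_cst.
    by rewrite I_cst addrK.
  by split; [exact: measurableT_comp | exists C].
rewrite (funext E); apply: measurable_funB => //.
apply: measurableT_comp => //.
pose f (p : T * R) := ((h p + C) * \1_D p.2)%:E.
have mf : measurable_fun setT f.
  apply/measurable_EFinP; apply: measurable_funM; first exact: measurable_funD.
  have mI : measurable_fun setT (\1_D : measurableTypeR R -> R).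
    exact/measurable_indicP.
  exact: (measurableT_comp mI measurable_snd).
have f0 p : (0 <= f p)%E.
  rewrite lee_fin mulr_ge0 //; have := hC p; rewrite ler_norml; lra.
have := measurable_fun_fubini_tonelli_F (m2 := mu) f mf f0.
congr measurable_fun; apply/funext => t.
rewrite /fubini_F [RHS]integral_mkcond; apply: eq_integral => x _.
by rewrite /f /= patchE indicE; case: (x \in D); rewrite ?mulr1 ?mulr0.
Qed.

End IteratedIntegrals.

Lemma mkseqSl T (f : nat -> T) n : mkseq f n.+1 = f 0%N :: mkseq (f \o S) n.
Proof. by rewrite /mkseq /= (iotaDl 1 0) -map_comp. Qed.

(** * Joint measurability and integrals over a box *)

Section SeqMeasurable.
Variable R : realType.

(* Joint measurability in [n] variables, tested on all measurable curves. *)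
Definition seq_measurable (n : nat) (F : seq R -> R) : Prop :=
  forall d (T : measurableType d) (X : nat -> T -> R),
    (forall i, measurable_fun setT (X i)) ->
    measurable_fun setT (fun t => F (mkseq (X^~ t) n)).

Lemma seq_measurable_cons n F x :
  seq_measurable n.+1 F -> seq_measurable n (fun s => F (x :: s)).
Proof.
move=> mF d T X mX.
have := mF d T (fun i => if i is i'.+1 then X i' else fun=> x).
under [X in (_ -> measurable_fun _ X) -> _]eq_fun do rewrite mkseqSl.
by apply; case.
Qed.

Lemma seq_measurable_sum n I (r : seq I) (F : I -> seq R -> R) :
  (forall i, seq_measurable n (F i)) ->
  seq_measurable n (fun s => \sum_(i <- r) F i s).
Proof.
by move=> mF d T X mX; apply: measurable_sum => i; exact: mF.
Qed.

Lemma seq_measurable_cat n s F :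
  seq_measurable (size s + n) F -> seq_measurable n (fun s' => F (s ++ s')).
Proof.
elim: s F => [|x s IH] F //= mF.
by apply: (IH (fun s' => F (x :: s'))); exact: seq_measurable_cons.
Qed.

Variable L : R.
Hypothesis L0 : 0 < L.
Local Notation mu := (@lebesgue_measure R).
Local Notation D := (`]0%R, L[%classic : set R).

Let mD : measurable (D : set (measurableTypeR R)). Proof. exact: measurable_itv. Qed.

Let muD : mu D = L%:E.
Proof. by rewrite lebesgue_measure_itv /= lte_fin L0 oppr0 adde0. Qed.

Fixpoint box_int (n : nat) (F : seq R -> R) : R :=
  if n is n'.+1 then Rintegral mu D (fun x => box_int n' (fun s => F (x :: s)))
  else F [::].

(** Both claims are proved together, since [measurable_I_param] needs a bound on the inner integral.
    The [p] leading coordinates stay free, so that an integration variable can join them at the next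
    level. *)
Lemma box_int_measurable_bound m :
  (forall p F C, (forall s, `|F s| <= C) -> seq_measurable (p + m) F ->
     forall d (T : measurableType d) (X : nat -> T -> R),
       (forall i, measurable_fun setT (X i)) ->
       measurable_fun setT (fun t => box_int m (fun s => F (mkseq (X^~ t) p ++ s))))
  /\ (forall F C, (forall s, `|F s| <= C) -> seq_measurable m F ->
       `|box_int m F| <= C * L ^+ m).
Proof.
elim: m => [|m [IHm IHb]].
  split=> [p F C FC mF d T X mX|F C FC mF] /=; last by rewrite mulr1.
  under eq_fun do rewrite cats0.
  by have := mF d T X mX; rewrite addn0.
split=> [p F C FC mF d T X mX|F C FC mF] /=.
  (* Adjoin the integration variable to the parameter space, as coordinate [p]. *)
  pose Y i (q : T * R) := if (i < p)%N then X i q.1 else q.2.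
  have YE t x : mkseq (Y^~ (t, x)) p.+1 = rcons (mkseq (X^~ t) p) x.
    rewrite mkseqS /Y /= ltnn; congr rcons; apply/eq_in_map => i.
    by rewrite mem_iota add0n /= => ->.
  have mY i : measurable_fun setT (Y i).
    rewrite /Y; case: (i < p)%N; last exact: measurable_snd.
    exact: (measurableT_comp (mX i) measurable_fst).
  have mF' : seq_measurable (p.+1 + m) F by rewrite addSnnS.
  have : measurable_fun setT (fun t => Rintegral mu D (fun x =>
      box_int m (fun s => F (mkseq (Y^~ (t, x)) p.+1 ++ s)))).
    apply: (measurable_I_param mD muD (C := C * L ^+ m) (IHm p.+1 F C FC mF' _ _ Y mY)).
    move=> q; apply: IHb => [s|]; first exact: FC.
    by apply: seq_measurable_cat; rewrite size_mkseq.
  congr measurable_fun; apply/funext => t; apply: eq_Rintegral => x _.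
  by congr box_int; apply/funext => s; rewrite YE cat_rcons.
rewrite exprSr mulrA; apply: (I_bound mD muD) => // [|x].
  split; last by exists (C * L ^+ m) => x; apply: IHb => //; exact: seq_measurable_cons.
  by apply: (IHm 1%N F C FC mF _ (measurableTypeR R) (fun=> idfun)) => i; exact: measurable_id.
by apply: IHb => //; exact: seq_measurable_cons.
Qed.

Definition nice n (F : seq R -> R) : Prop :=
  (exists C, forall s, `|F s| <= C) /\ seq_measurable n F.

Lemma nice_cons n F x : nice n.+1 F -> nice n (fun s => F (x :: s)).
Proof.
case=> -[C FC] mF; split; last exact: seq_measurable_cons.
by exists C => s; exact: FC.
Qed.

Lemma nice_sum n I (r : seq I) (F : I -> seq R -> R) :
  (forall i, nice n (F i)) -> nice n (fun s => \sum_(i <- r) F i s).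
Proof.
move=> H; split; last by apply: seq_measurable_sum => i; case: (H i).
elim: r => [|i r [C HC]].
  by exists 0 => s; rewrite big_nil normr0.
have [[E HE] _] := H i.
by exists (E + C) => s; rewrite big_cons (le_trans (ler_normD _ _)) ?lerD.
Qed.

Lemma nice_seqsum n m U (V : seq U) (F : seq U -> seq R -> R) :
  (forall c, nice n (F c)) -> nice n (fun s => seqsum m V (fun c => F c s)).
Proof.
elim: m F => [|m IH] F mF //=; apply: nice_sum => i.
exact: (IH (fun c => F (i :: c))).
Qed.

Lemma box_int_bm m F : nice m.+1 F ->
  bounded_measurable (fun x => box_int m (fun s => F (x :: s))).
Proof.
case=> -[C FC] mF; have [mm mb] := box_int_measurable_bound m; split.
  by apply: (mm 1%N F C FC mF _ (measurableTypeR R) (fun=> idfun)) => i; exact: measurable_id.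
by exists (C * L ^+ m) => x; apply: mb => //; exact: seq_measurable_cons.
Qed.

Lemma box_int_seqsum n m U (V : seq U) (F : seq U -> seq R -> R) :
  (forall c, nice m (F c)) ->
  box_int m (fun s => seqsum n V (fun c => F c s)) =
  seqsum n V (fun c => box_int m (F c)).
Proof.
elim: m F => [|m IH] F nF //=.
have E x : box_int m (fun s => seqsum n V (F^~ (x :: s))) =
    seqsum n V (fun c => box_int m (fun s => F c (x :: s))).
  by apply: (IH (fun c s => F c (x :: s))) => c; exact: nice_cons.
under eq_Rintegral do rewrite E.
by apply: (I_seqsum mD muD) => // c; exact: box_int_bm.
Qed.

(** Each new coordinate misses the finitely many earlier ones almost everywhere, so only lists of
    distinct entries matter. *)
Lemma box_int_uniq m F C (avoid : seq R) : nice m F -> uniq avoid ->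
  (forall s, size s = m -> uniq (s ++ avoid) -> all (fun x => 0 < x < L) s ->
     F s = C) ->
  box_int m F = C * L ^+ m.
Proof.
elim: m F avoid => [|m IH] F avoid nF uav FC.
  by rewrite mulr1; apply: FC.
rewrite exprSr mulrA.
apply: (I_ae_cst mD muD (s := avoid)) => [|x Dx xav]; first exact: box_int_bm.
apply: (IH _ (x :: avoid)); [exact: nice_cons | by rewrite /= xav |].
move=> s sz us sL; apply: FC; first by rewrite /= sz.
  by rewrite -[x :: s]/([:: x] ++ s) -catA uniq_catCA.
by rewrite /= sL andbT; move: Dx; rewrite /= in_itv.
Qed.

End SeqMeasurable.

(** * Splitting the unit interval into cells *)

Section OrderFunctions.
Variable R : realType.

(** Finitely many patterns of strict comparisons among 0 and the entries occur, so [F] is a finite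
    combination of products of indicators of such comparisons. *)
Lemma seq_measurable_order n (F : seq R -> R) :
  (forall a a', size a = n -> size a' = n ->
     (forall i j, (i <= n)%N -> (j <= n)%N ->
        (nth 0 (0 :: a) i < nth 0 (0 :: a) j)
        = (nth 0 (0 :: a') i < nth 0 (0 :: a') j)) -> F a = F a') ->
  seq_measurable n F.
Proof.
move=> HF d T X mX.
pose code (a : seq R) : {ffun 'I_n.+1 * 'I_n.+1 -> bool} :=
  [ffun p => nth 0 (0 :: a) (p.1 : 'I_n.+1) < nth 0 (0 :: a) (p.2 : 'I_n.+1)].
(* A list with pattern [b]. The default for an impossible pattern is harmless: its product of
   indicators is always 0. *)
pose rep b := xget [::] [set a | size a = n /\ code a = b]%classic.
have FE a : size a = n -> F a = \sum_b F (rep b) * \prod_p (code a p == b p)%:R.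
  move=> sz; rewrite (bigD1 (code a)) //= big1 => [|p _]; last by rewrite eqxx.
  rewrite mulr1 [X in _ + X]big1 ?addr0 => [|b /eqP b_neq].
    have := @xgetPex _ [::] [set a' | size a' = n /\ code a' = code a]%classic.
    move=> /(_ (ex_intro _ a (conj sz erefl))) [sz' c']; apply: HF => //.
    move=> i j il jl; have il' : (i < n.+1)%N by []; have jl' : (j < n.+1)%N by [].
    by move/ffunP: c' => /(_ (Ordinal il', Ordinal jl')); rewrite !ffunE.
  have [p Hp] : exists p, code a p != b p.
    apply/existsP; apply: contra_notT b_neq; rewrite negb_exists => /forallP H.
    by apply/ffunP => p; have := H p; rewrite negbK => /eqP ->.
  by rewrite (bigD1 p) //= (negbTE Hp) mul0r mulr0.
under eq_fun => t do rewrite FE ?size_mkseq //.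
apply: measurable_sum => b; apply: measurable_funM => //.
apply: measurable_prod => p _.
have mZ i : (i < n.+1)%N -> measurable_fun setT (fun t => nth 0 (0 :: mkseq (X^~ t) n) i).
  case: i => [|i] ilt /=; first exact: measurable_cst.
  under eq_fun do rewrite nth_mkseq //.
  exact: mX.
have -> : (fun t => (code (mkseq (X^~ t) n) p == b p)%:R : R) =
   (fun t => if nth 0 (0 :: mkseq (X^~ t) n) p.1 < nth 0 (0 :: mkseq (X^~ t) n) p.2
     then (b p)%:R else (~~ b p)%:R).
  apply/funext => t; rewrite ffunE; case: (_ < _); by case: (b p).
by apply: measurable_fun_ifT => //; apply: measurable_fun_ltr; exact: mZ.
Qed.

End OrderFunctions.

Section Decomposition.
Variable R : realType.
Local Notation mu := (@lebesgue_measure R).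

Lemma Rintegral_translate (g : R -> R) (s L : R) :
  0 < L -> bounded_measurable g ->
  Rintegral mu `]s, s + L[%classic (fun x => g (x - s))
  = Rintegral mu `]0, L[%classic g.
Proof.
move=> L0 bg.
pose phi : measurableTypeR R -> measurableTypeR R := fun x => x - s.
have mphi : measurable_fun setT phi by exact: measurable_funB.
have mD a b : measurable (`]a, b[%classic : set (measurableTypeR R)).
  exact: measurable_itv.
have pre : (phi @^-1` `]0, L[)%classic = `]s, s + L[%classic.
  apply/seteqP; split => x /=; rewrite !in_itv /= /phi; lra.
rewrite /Rintegral; congr fine; rewrite -pre.
have := @integral_pushforward _ _ _ _ _ phi mphi mu `]0, L[%classic (EFin \o g).
rewrite /= => <- //; last 2 first.
- by apply/measurable_EFinP; case: bg.
- rewrite pre; apply: (@bm_integrable R _ L (mD _ _) _ (fun x => g (phi x))).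
    rewrite lebesgue_measure_itv /= lte_fin ltrDl L0 -EFinB; congr EFin; ring.
  case: bg => mg [C gC]; split; last by exists C => x.
  exact: (measurableT_comp mg mphi).
(* The image of Lebesgue measure under the translation agrees with it on half-open intervals, hence
   on all measurable sets. *)
apply/esym; apply: eq_measure_integral => A mA _.
apply: lebesgue_measure_unique => // _ [[u v]] _ <-.
rewrite [RHS](_ : _ = mu `]u + s, v + s]%classic); last first.
  congr (lebesgue_measure _); apply/seteqP; split => x /=; rewrite !in_itv /= /phi; lra.
rewrite !lebesgue_measure_itv /= !lte_fin ltrD2r.
by case: ifP => // _; rewrite -!EFinB; congr EFin; ring.
Qed.

Variables (L : R) (s : nat -> R) (labs : seq nat).
Hypothesis L0 : 0 < L.
Hypothesis s0 : forall j, j \in labs -> 0 <= s j /\ s j + L <= 1.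
Hypothesis labs_uniq : uniq labs.

Definition in_cell (j : nat) (x : R) : bool := (s j < x) && (x < s j + L).

Hypothesis cells_disjoint : forall i j x,
  i \in labs -> j \in labs -> in_cell i x -> in_cell j x -> i = j.

(** The mark of a point: its cell and its offset there. Disjointness of the cells makes the choice
    by [ohead] unambiguous. *)
Definition classify (x : R) : option (nat * R) :=
  ohead [seq (j, x - s j) | j <- labs & in_cell j x].

Lemma classify_in j x : j \in labs -> in_cell j x -> classify x = Some (j, x - s j).
Proof.
move=> jl jx; rewrite /classify; have -> : [seq i <- labs | in_cell i x] = [:: j].
  rewrite (@eq_in_filter _ _ (pred1 j)) ?filter_pred1_uniq // => i il /=.
  by apply/idP/eqP => [ix|-> //]; exact: cells_disjoint ix jx.
by [].
Qed.

Lemma classify_notin x : (forall j, j \in labs -> ~~ in_cell j x) -> classify x = None.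
Proof.
move=> H; rewrite /classify (@eq_in_filter _ _ pred0) ?filter_pred0 // => i il.
exact/negbTE/H.
Qed.

Lemma Rintegral_classify (g : nat -> R -> R) c :
  (forall j, bounded_measurable (g j)) ->
  Rintegral mu `[0, 1]%classic (fun x => if classify x is Some p then g p.1 p.2 else c)
  = (1 - (size labs)%:R * L) * c +
    \sum_(j <- labs) Rintegral mu `]0, L[%classic (g j).
Proof.
move=> bg.
(* The integrand is the constant [c] corrected on each cell; the corrections by [-c] produce the
   factor $1 - |labs|\,L$. *)
pose G j x : R := (in_cell j x)%:R * (g j (x - s j) - c).
have GE x : (if classify x is Some p then g p.1 p.2 else c) =
    c + \sum_(j <- labs) G j x.
  have [/hasP[j jl jx]|/hasPn H] := boolP (has (in_cell^~ x) labs).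
    rewrite (classify_in jl jx) /= (bigD1_seq j) //= /G jx mul1r big_seq_cond big1.
      by rewrite addr0 [RHS]addrC subrK.
    move=> i /andP[il ij]; case ix: (in_cell i x); last by rewrite mul0r.
    by rewrite (cells_disjoint il jl ix jx) eqxx in ij.
  rewrite classify_notin // big_seq big1 ?addr0 // => j jl.
  by rewrite /G (negbTE (H j jl)) mul0r.
under eq_Rintegral do rewrite GE.
have mD : measurable (`[0, 1]%classic : set (measurableTypeR R)).
  exact: measurable_itv.
have mu01 : mu `[0, 1]%classic = 1%:E by rewrite lebesgue_measure_itv /= lte01 oppr0 adde0.
have bg' j : bounded_measurable (fun x => g j x - c).
  by apply: bmD => //; exact: bm_cst.
have cell j : (fun x => (in_cell j x)%:R) = \1_(`]s j, s j + L[%classic : set R) :> (R -> R).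
  apply/funext => x; rewrite indicE; congr (nat_of_bool _)%:R.
  by apply/idP/idP; rewrite inE /= in_itv.
have bG j : bounded_measurable (G j).
  rewrite /G; case: (bg' j) => mg [C gC]; split.
    apply: measurable_funM.
      rewrite cell; apply/measurable_indicP; exact: measurable_itv.
    apply: (measurableT_comp (f := fun x => g j x - c) mg).
    exact: measurable_funB.
  exists C => x; rewrite normrM; case: (in_cell j x); rewrite ?normr1 ?mul1r //.
  by rewrite normr0 mul0r (le_trans _ (gC 0)).
rewrite (I_add mD mu01); [|exact: bm_cst|exact: bm_sum].
rewrite (I_cst mD mu01) mulr1 (I_sum mD mu01) //.
have GI j : j \in labs -> Rintegral mu `[0, 1]%classic (G j) =
    Rintegral mu `]0, L[%classic (g j) - c * L.
  move=> jl; have [sj0 sj1] := s0 jl.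
  transitivity (Rintegral mu `]s j, s j + L[%classic (fun x => g j (x - s j) - c)).
    rewrite [LHS]Rintegral_mkcond [RHS]Rintegral_mkcond; apply: eq_Rintegral => x _.
    rewrite !patchE /G !mem_setE /= !in_itv /= -/(in_cell j x).
    case: ifPn => x01; case jx: (in_cell j x); rewrite ?mul1r ?mul0r //.
    by case/negP: x01; move: jx; rewrite /in_cell; lra.
  rewrite (Rintegral_translate _ L0 (bg' j)).
  have mDL : measurable (`]0, L[%classic : set (measurableTypeR R)).
    exact: measurable_itv.
  have muL : mu `]0, L[%classic = L%:E.
    by rewrite lebesgue_measure_itv /= lte_fin L0 oppr0 adde0.
  rewrite (I_add mDL muL) //; last exact: bm_cst.
  by rewrite (I_cst mDL muL) mulNr.
rewrite big_seq (eq_bigr _ GI) -big_seq sumrB big_const_seq count_predT iter_addr_0.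
rewrite -mulr_natl; ring.
Qed.

End Decomposition.

(** * Cube integrals as sums over labels and integrals over offsets *)

Section CubeIntegral.
Variable R : realType.
Local Notation mu := (@lebesgue_measure R).
Variables (L : R) (s : nat -> R) (labs : seq nat).
Hypothesis L0 : 0 < L.
Hypothesis s0 : forall j, j \in labs -> 0 <= s j /\ s j + L <= 1.
Hypothesis labs_uniq : uniq labs.
Hypothesis cells_disjoint : forall i j x,
  i \in labs -> j \in labs -> in_cell L s i x -> in_cell L s j x -> i = j.
Local Notation classify := (classify L s labs).
Local Notation p0 := (1 - (size labs)%:R * L).

Definition label_nice (H : seq (nat * R) -> R) : Prop :=
  (exists C, forall l, `|H l| <= C) /\
  forall m c, seq_measurable m (fun a => H (zip c a)).

Lemma label_nice_zip H m c : label_nice H -> nice m (fun a => H (zip c a)).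
Proof. by case=> -[C HC] mH; split=> //; exists C => a; exact: HC. Qed.

Lemma label_nice_cons H j x : label_nice H -> label_nice (fun l => H ((j, x) :: l)).
Proof.
case=> -[C HC] mH; split; first by exists C => l; exact: HC.
by move=> m c; exact: (seq_measurable_cons (F := fun a => H (zip (j :: c) a)) x (mH m.+1 (j :: c))).
Qed.

Definition labelled_int m (H : seq (nat * R) -> R) : R :=
  seqsum m labs (fun c => box_int L m (fun a => H (zip c a))).

Let mD : measurable (`]0%R, L[%classic : set (measurableTypeR R)).
Proof. exact: measurable_itv. Qed.

Let muD : mu `]0%R, L[%classic = L%:E.
Proof. by rewrite lebesgue_measure_itv /= lte_fin L0 oppr0 adde0. Qed.

Lemma labelled_int_bm m H j : label_nice H ->
  bounded_measurable (fun x => labelled_int m (fun l => H ((j, x) :: l))).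
Proof.
move=> nH; apply: bm_seqsum => c.
exact: (box_int_bm L0 (label_nice_zip m.+1 (j :: c) nH)).
Qed.

Lemma labelled_intS m H : label_nice H ->
  \sum_(j <- labs) Rintegral mu `]0, L[%classic
     (fun x => labelled_int m (fun l => H ((j, x) :: l))) = labelled_int m.+1 H.
Proof.
move=> nH; rewrite {2}/labelled_int /=; apply: eq_bigr => j _.
rewrite (I_seqsum mD muD) // => c.
exact: (box_int_bm L0 (label_nice_zip m.+1 (j :: c) nH)).
Qed.

(** A binomial expansion: [m] of the [n] points fall into cells, and each other point contributes
    the uncovered length [p0]. *)
Lemma cube_int_classify n H : label_nice H ->
  cube_int n (fun xs => H (pmap classify xs)) =
  \sum_(m < n.+1) 'C(n, m)%:R * p0 ^+ (n - m) * labelled_int m H.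
Proof.
elim: n H => [|n IH] H nH; first by rewrite big_ord1 /= !mul1r.
pose S H := \sum_(m < n.+1) 'C(n, m)%:R * p0 ^+ (n - m) * labelled_int m H.
transitivity (Rintegral mu `[0, 1]%classic (fun x =>
    if classify x is Some p then S (fun l => H ((p.1, p.2) :: l)) else S H)).
  apply: eq_Rintegral => x _; case E : (classify x) => [[j y]|] /=.
    rewrite /S -IH; last exact: label_nice_cons.
    by congr cube_int; apply/funext => xs; rewrite /= E.
  by rewrite /S -IH //; congr cube_int; apply/funext => xs; rewrite /= E.
have bS j : bounded_measurable (fun x => S (fun l => H ((j, x) :: l))).
  by apply: bm_sum => m; apply: bmM; exact: labelled_int_bm.
rewrite (Rintegral_classify L0 s0 labs_uniq cells_disjoint
  (g := fun j x => S (fun l => H ((j, x) :: l)))) //.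
have -> : \sum_(j <- labs) Rintegral mu `]0, L[%classic
     (fun x => S (fun l => H ((j, x) :: l))) =
   \sum_(m < n.+1) 'C(n, m)%:R * p0 ^+ (n - m) * labelled_int m.+1 H.
  under eq_bigr => j _.
    rewrite (I_sum mD muD); last by move=> m; apply: bmM; exact: labelled_int_bm.
    under eq_bigr => m _ do rewrite (I_scale mD muD _ (labelled_int_bm m j nH)).
    over.
  rewrite exchange_big /=; apply: eq_bigr => m _.
  by rewrite -mulr_sumr labelled_intS.
rewrite /S; set b := labelled_int^~ H.
rewrite big_ord_recl [RHS]big_ord_recl /= !bin0 !subn0 mulrDr -addrA; congr (_ + _).
  by rewrite exprS !mulrA mulr1 mul1r.
(* Pascal's rule, according to whether the first point misses the cells or falls into one. *)
have -> : \sum_(i < n.+1) 'C(n.+1, bump 0 i)%:R * p0 ^+ (n.+1 - bump 0 i) *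
      labelled_int (bump 0 i) H =
    \sum_(i < n.+1) 'C(n, i.+1)%:R * p0 ^+ (n - i) * b i.+1 +
    \sum_(m < n.+1) 'C(n, m)%:R * p0 ^+ (n - m) * b m.+1.
  rewrite -big_split; apply: eq_bigr => i _ /=.
  by rewrite /bump /= add1n subSS binS natrD !mulrDl.
congr (_ + _); rewrite [RHS]big_ord_recr /= bin_small // !mul0r addr0 mulr_sumr.
apply: eq_bigr => i _; rewrite /bump /= add1n; have := ltn_ord i => i_n.
by rewrite -[in RHS](subnSK i_n) exprS /b !mulrA [p0 * _]mulrC.
Qed.

(** The label sum goes inside the integral, where it is the constant [Z] off the null set of
    ties. *)
Lemma labelled_int_const m H Z : label_nice H ->
  (forall a, size a = m -> uniq a -> all (fun x => 0 < x < L) a ->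
     seqsum m labs (fun c => H (zip c a)) = Z) ->
  labelled_int m H = Z * L ^+ m.
Proof.
move=> nH HZ; rewrite /labelled_int -box_int_seqsum //; last first.
  by move=> c; exact: label_nice_zip.
apply: (box_int_uniq L0 (avoid := [::])) => // [|a sz].
  by apply: nice_seqsum => c; exact: label_nice_zip.
by rewrite cats0; exact: HZ.
Qed.

End CubeIntegral.

(** * Chains and words *)

Lemma undup_pmap (T U : eqType) (f : T -> option U) (s : seq T) :
  (forall x y u, x \in s -> y \in s -> f x = Some u -> f y = Some u -> x = y) ->
  undup (pmap f s) = pmap f (undup s).
Proof.
elim: s => //= x s IH inj.
have {}IH : undup (pmap f s) = pmap f (undup s).
  by apply: IH => y z u ys zs; apply: inj; rewrite inE ?ys ?zs orbT.
case E : (f x) => [u|] /=; last by rewrite IH; case: ifP => //= _; rewrite E.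
have -> : (u \in pmap f s) = (x \in s).
  rewrite mem_pmap; apply/mapP/idP => [[y ys Ey]|xs]; last by exists x.
  by rewrite (inj x y u) // inE ?eqxx // ys orbT.
by rewrite IH; case: ifP => //= _; rewrite E.
Qed.

Lemma undup_map_in (T U : eqType) (f : T -> U) (s : seq T) :
  {in s &, injective f} -> undup (map f s) = map f (undup s).
Proof.
have pm (r : seq T) : map f r = pmap (Some \o f) r by elim: r => //= x r ->.
move=> inj; rewrite !pm undup_pmap // => x y u xs ys /= [fx] [fy].
by apply: inj => //; rewrite fx.
Qed.

(** A permutation of the offsets can be transferred to the labels, and the sum over all label lists
    is symmetric. Exchanging adjacent sums moves one entry to the front. *)
Lemma seqsum_zip_perm (A : nmodType) (U V : eqType) (labs : seq U) (a a' : seq V)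
    (F : seq (U * V) -> A) :
  (forall l l', perm_eq l l' -> F l = F l') -> perm_eq a a' ->
  seqsum (size a) labs (fun c => F (zip c a)) =
  seqsum (size a') labs (fun c => F (zip c a')).
Proof.
move=> FP; have FPc (G : seq (U * V) -> A) p :
    (forall l l', perm_eq l l' -> G l = G l') ->
    forall l l', perm_eq l l' -> G (p :: l) = G (p :: l').
  by move=> GP l l' ll'; apply: GP; rewrite perm_cons.
have move_front x a1 a2 (G : seq (U * V) -> A) :
    (forall l l', perm_eq l l' -> G l = G l') ->
    seqsum (size (a1 ++ x :: a2)) labs (fun c => G (zip c (a1 ++ x :: a2))) =
    seqsum (size (x :: a1 ++ a2)) labs (fun c => G (zip c (x :: a1 ++ a2))).
  elim: a1 G => [|y a1 IH] G GP //=.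
  under eq_bigr => u _ do rewrite (IH (fun l => G ((u, y) :: l)) (FPc _ _ GP)).
  rewrite exchange_big /=; apply: eq_bigr => u _; apply: eq_bigr => w _.
  apply: eq_seqsum => c; apply: GP.
  have /= -> := perm_cat2r (zip c (a1 ++ a2)) [:: (w, y); (u, x)] [:: (u, x); (w, y)].
  by apply/permPl; exact: (perm_catC [:: (w, y)] [:: (u, x)]).
elim: a a' F FP => [|x a IH] a' F FP.
  by rewrite perm_sym => /perm_nilP ->.
move=> aa'; have xa' : x \in a' by rewrite -(perm_mem aa') mem_head.
case/splitPr: a' / xa' aa' => a1 a2 aa'.
rewrite move_front //=; apply: eq_bigr => u _.
apply: (IH _ (fun l => F ((u, x) :: l))); first exact: FPc.
by rewrite -(perm_cons x) (perm_trans aa') // perm_catC /= perm_cons perm_catC.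
Qed.

Section Chains.
Variable R : realType.
Implicit Types (b x : R) (l : seq (nat * R)).

(* Number of chains [b < y_j < ... < y_1] with [(i, y_i)] in [l]. *)
Fixpoint chains (j : nat) b l : nat :=
  if j is j'.+1 then
    (\sum_(p <- l | (p.1 == j) && (b < p.2)%R) chains j' p.2 l)%N
  else 1%N.

Lemma chains_perm j b l l' : perm_eq l l' -> chains j b l = chains j b l'.
Proof.
move=> ll'; elim: j b => //= j IH b; rewrite (perm_big _ ll') /=.
by apply: eq_bigr => p _; exact: IH.
Qed.

Lemma chains_le j b l :
  (chains j b l <= \prod_(1 <= i < j.+1) count_mem i (unzip1 l))%N.
Proof.
elim: j b => [|j IH] b; first by rewrite big_nil.
rewrite big_nat_recr //= mulnC count_map -sum1_count big_distrl /=.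
rewrite big_mkcond [leqRHS]big_mkcond; apply: leq_sum => p _.
by case: eqP => //= _; case: ifP => // _; rewrite mul1n.
Qed.

Lemma chains_map (f : R -> R) (S : seq R) j b l : b \in S ->
  {subset unzip2 l <= S} -> {in S &, {mono f : x y / x < y}} ->
  chains j (f b) [seq (p.1, f p.2) | p <- l] = chains j b l.
Proof.
move=> bS lS fS; elim: j b bS => //= j IH b bS.
rewrite big_map big_seq_cond [RHS]big_seq_cond /=.
apply: eq_big => [p|p /andP[pl _]].
  by case pl : (p \in l) => //=; rewrite fS // lS // map_f.
by apply: IH; rewrite lS // map_f.
Qed.

Lemma chains_cons_le j b x l p : p.2 <= b -> chains j b (p :: l) = chains j b l.
Proof.
elim: j b => //= j IH b pb; rewrite big_cons ltNge pb andbF /=.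
by apply: eq_bigr => q /andP[_ bq]; apply: IH; rewrite (le_trans pb) // ltW.
Qed.

(** The head has the least offset, so it can only be the bottom of a chain, labelled [j]; this is
    the recursion of [embed]. *)
Lemma chains_sorted j b c a : size c = size a -> path <%R b a ->
  chains j b (zip c a) = embed j c.
Proof.
elim: a b c j => [|y a IH] b [|x c] [|j] //=; rewrite ?embed0 // ?big_nil //.
move=> [sz] /andP[b_y ya]; rewrite big_cons /= b_y andbT embedS.
rewrite -(IH y c j) // -(IH y c j.+1) //= (chains_cons_le _ b) //.
have lt_y p : p \in zip c a -> y < p.2.
  move=> pca; have : p.2 \in a by rewrite -(unzip2_zip (eq_leq (esym sz))) map_f.
  by move/(allP (order_path_min lt_trans ya)).
rewrite addnC -(_ : \sum_(p <- zip c a | (p.1 == j.+1) && (y < p.2)%R) chains j p.2 (zip c a)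
   = \sum_(p <- zip c a | (p.1 == j.+1) && (b < p.2)%R) chains j p.2 ((x, y) :: zip c a))%N.
  by case: (_ == _); rewrite ?mul1n ?mul0n ?addn0 // addnC.
rewrite big_seq_cond [RHS]big_seq_cond; apply: eq_big => [p|p].
  by case pl : (p \in zip c a) => //=; rewrite lt_y // (lt_trans b_y) // lt_y.
by case/andP => pl _; rewrite chains_cons_le //= ltW // lt_y.
Qed.

Variables (K : nat) (M : nat -> nat) (q : R).

(** The integrand as a function of the marks; [undup] matches the one in [vertices] and [mcount], so
    the translation is exact even with repeated points. *)
Definition chain_weight l : R :=
  (has_counts K M (unzip1 (undup l)))%:R * q ^+ chains K 0 (undup l).

Lemma chain_weight_perm l l' : perm_eq l l' -> chain_weight l = chain_weight l'.
Proof.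
move=> ll'; have ull' : perm_eq (undup l) (undup l').
  by apply: perm_undup; exact: perm_mem.
rewrite /chain_weight (chains_perm _ _ ull'); congr ((nat_of_bool _)%:R * _).
apply: eq_all => j; congr (_ == _).
by move/permP: (perm_map fst ull'); exact.
Qed.

(** Since [q] is any real, boundedness comes from the event: prescribed counts bound the number of
    chains, and the base [1 + |q|] is at least 1. *)
Lemma chain_weight_bound l :
  `|chain_weight l| <= (1 + `|q|) ^+ (\prod_(1 <= i < K.+1) M i).
Proof.
have q1 : 1 <= 1 + `|q| by rewrite lerDl.
rewrite /chain_weight; case: (boolP (has_counts _ _ _)) => [/allP HM|_]; last first.
  by rewrite mul0r normr0 exprn_ge0 // (le_trans ler01).
rewrite mul1r normrX; apply: le_trans (_ : (1 + `|q|) ^+ chains K 0 (undup l) <= _).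
  by rewrite lerXn2r ?nnegrE ?addr_ge0 // lerDr.
apply: ler_weXn2l => //; apply: leq_trans (chains_le _ _ _) _.
rewrite big_nat [leqRHS]big_nat leq_eqVlt; apply/orP; left; apply/eqP.
apply: eq_bigr => i iK; apply/eqP/HM; rewrite mem_iota; lia.
Qed.

Lemma chain_weight_measurable m c :
  seq_measurable m (fun a => chain_weight (zip c a)).
Proof.
apply: seq_measurable_order => a a' sza sza' cmp.
have same i j : (i <= m)%N -> (j <= m)%N -> nth 0 (0 :: a) i = nth 0 (0 :: a) j ->
    nth 0 (0 :: a') i = nth 0 (0 :: a') j.
  move=> im jm E; have := cmp i j im jm; have := cmp j i jm im.
  by rewrite E ltxx; case: ltgtP.
(* The order isomorphism from the values of [0 :: a] to those of [0 :: a']; [same] makes it respect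
   ties. It fixes 0, the bound from which chains start. *)
pose f x := nth 0 (0 :: a') (index x (0 :: a)).
have fE i : (i <= m)%N -> f (nth 0 (0 :: a) i) = nth 0 (0 :: a') i.
  move=> im; have ia : nth 0 (0 :: a) i \in 0 :: a by rewrite mem_nth //= ltnS sza.
  apply: same => //; last exact: nth_index.
  by move: ia; rewrite -index_mem /= sza ltnS.
have fmono : {in 0 :: a &, {mono f : x y / x < y}}.
  move=> x y xa ya; rewrite -(nth_index 0 xa) -(nth_index 0 ya).
  move: xa ya; rewrite -!index_mem /= sza !ltnS => xa ya.
  by rewrite !fE // -cmp.
have f0 : f 0 = 0 by have := fE 0%N (leq0n _).
have a'E : a' = map f a.
  apply: (@eq_from_nth _ 0); rewrite ?size_map ?sza // sza' => i im.
  by rewrite (nth_map 0) ?sza //; have := fE i.+1 im.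
have -> : zip c a' = [seq (p.1, f p.2) | p <- zip c a].
  by rewrite a'E; elim: (c) (a) => [|x c' IH] [|y a''] //=; rewrite IH.
have zipS : {subset unzip2 (zip c a) <= 0 :: a}.
  move=> y /mapP[[u v] uv ->] /=; rewrite inE; apply/orP; right.
  elim: (c) (a) uv => [|x c' IH] [|z a''] //=.
  by rewrite !inE => /orP[/eqP[_ ->]|/IH ->]; rewrite ?eqxx ?orbT.
rewrite /chain_weight undup_map_in; last first.
  move=> [i x] [j y] xl yl /= [-> fxy]; congr pair.
  have xa : x \in 0 :: a by apply: zipS; exact: (map_f snd xl).
  have ya : y \in 0 :: a by apply: zipS; exact: (map_f snd yl).
  by have := fmono x y xa ya; have := fmono y x ya xa; rewrite fxy ltxx; case: ltgtP.
rewrite -{2}f0 (chains_map (S := 0 :: a)) ?mem_head //; last first.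
  by move=> y /mapP[p pl ->]; apply: zipS; rewrite map_f // -mem_undup.
by congr ((nat_of_bool (has_counts _ _ _))%:R * _); rewrite /unzip1 -map_comp.
Qed.

Lemma chain_weight_nice : label_nice chain_weight.
Proof.
split; last exact: chain_weight_measurable.
by exists ((1 + `|q|) ^+ (\prod_(1 <= i < K.+1) M i)) => l; exact: chain_weight_bound.
Qed.

(* Relabelling the offsets by rank turns the sum over labellings into a sum over words. *)
Lemma sum_chain_weight V (a : seq R) : uniq a -> all (fun x => 0 < x) a ->
  seqsum (size a) V (fun c => chain_weight (zip c a)) =
  seqsum (size a) V (fun c => (has_counts K M c)%:R * q ^+ embed K c).
Proof.
move=> ua a0; have sa : perm_eq a (sort <=%R a) by rewrite perm_sym perm_sort.
rewrite (seqsum_zip_perm _ chain_weight_perm sa) -(size_sort <=%R a).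
apply: eq_in_seqsum => c sz _.
have sz' : (size c <= size (sort <=%R a))%N by rewrite sz.
have sz'' : (size (sort <=%R a) <= size c)%N by rewrite sz.
have uz : uniq (zip c (sort <=%R a)).
  by apply: (@map_uniq _ _ snd); rewrite -/(unzip2 _) unzip2_zip // sort_uniq.
rewrite /chain_weight undup_id // unzip1_zip // chains_sorted //.
rewrite lt_path_sortedE all_sort a0 /= lt_sorted_uniq_le sort_uniq ua /=.
exact: sort_le_sorted.
Qed.

End Chains.

(** * Paths and lenses *)

Section Paths.
Variables (R : realType) (r0 : R) (V : seq R).

(** The [n]-hop paths from 0 to [x], with the last hop removed first, in step with the recursion of
    [chains]. *)
Fixpoint hop_paths (n : nat) (x : R) : nat :=
  if n is n'.+1 then (\sum_(y <- V | adj r0 y x) hop_paths n' y)%N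
  else (x == 0)%R.

Lemma seqsum_hop_paths n x :
  seqsum n V (fun s => ((head 0 (rcons s x) == 0) && sorted (adj r0) (rcons s x))%R : nat)
  = hop_paths n x.
Proof.
elim: n x => [|n IH] x; first by rewrite /= andbT.
rewrite seqsum_rcons /= [RHS]big_mkcond; apply: eq_bigr => y _.
have E s : sorted (adj r0) (rcons (rcons s y) x) =
    sorted (adj r0) (rcons s y) && adj r0 y x.
  by case: s => [|z s] /=; rewrite ?andbT // rcons_path last_rcons.
have Eh s : head 0 (rcons (rcons s y) x) = head 0 (rcons s y) by case: s.
under eq_seqsum => s do rewrite E Eh andbA.
case: ifP => yx; last first.
  by apply: etrans (seqsum0 nat n V); apply: eq_seqsum => s; rewrite andbF.
by rewrite -IH; apply: eq_seqsum => s; rewrite andbT.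
Qed.

Lemma hop_paths_lt n x : hop_paths n.+1 x != 0%N -> x < n.+1%:R * r0.
Proof.
elim: n x => [|n IH] x /=.
  rewrite mul1r; apply: contraNT; rewrite -leNgt => r0x; apply/eqP.
  rewrite big1 // => y; rewrite /adj => /andP[_ yx].
  case: eqP => // y0; exfalso; move: yx; rewrite y0 sub0r normrN; have := ler_norm x; lra.
apply: contraNT; rewrite -leNgt => r0x; apply/eqP.
rewrite big1 // => y /andP[_ yx]; apply/eqP; apply: contraTT yx => /IH yn.
rewrite -leNgt distrC; apply: le_trans (ler_norm _).
by move: r0x yn; rewrite -(addn1 n.+1) natrD; lra.
Qed.

End Paths.

Lemma sigma_hop_paths (R : realType) k (r0 : R) xs :
  sigma k r0 xs = hop_paths r0 (vertices xs) k 1.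
Proof.
rewrite /sigma; set V := vertices xs.
pose P (s : seq R) := [&& head 0 s == 0, last 0 s == 1 & sorted (adj r0) s].
transitivity (seqsum k.+1 V (fun s => P s : nat)).
  rewrite -(card_ffun_seqsum _ V 0); apply: eq_card => f; rewrite !inE.
  set s := map _ _; have sz : size s = k.+1 by rewrite size_map size_enum_ord.
  have sE (i : 'I_k.+1) : nth 0 s i = nth 0 V (f i).
    by rewrite (nth_map i) ?size_enum_ord // nth_ord_enum.
  rewrite /P -nth0 -nth_last sz -andbA -(sE ord0) -(sE ord_max) /=.
  congr [&& _, _ & _]; apply/forallP/(sortedP 0) => [H i|H i].
    rewrite sz ltnS => ik; have ik' : (i < k.+1)%N by rewrite ltnW.
    have /implyP/(_ ik) := H (Ordinal ik').
    by rewrite -!sE /= inordK.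
  by apply/implyP => ik; rewrite -!sE inordK //; apply: H; rewrite sz.
have V1 : 1 \in V by rewrite mem_undup !inE eqxx orbT.
rewrite seqsum_rcons (bigD1_seq 1) ?undup_uniq //= big1 ?addr0 => [|x x1].
  rewrite -seqsum_hop_paths; apply: eq_seqsum => s.
  by rewrite /P last_rcons eqxx.
apply: etrans (seqsum0 nat k V); apply: eq_seqsum => s.
by rewrite /P last_rcons (negbTE x1) andbF.
Qed.

Section Lenses.
Variables (R : realType) (r0 : R) (k : nat).
Hypothesis k2 : (2 <= k)%N.
Hypothesis r0_gt : k%:R^-1 < r0.
Hypothesis r0_lt : r0 < (k - 1)%:R^-1.

Definition lens_length : R := k%:R * r0 - 1.
Definition lens_start (j : nat) : R := 1 - (k - j)%:R * r0.
Local Notation L := lens_length.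
Local Notation s := lens_start.
Local Notation labs := (iota 1 k.-1).

Lemma lens_length_gt0 : 0 < L.
Proof. by rewrite subr_gt0 -ltr_pdivrMl ?mulr1 // ltr0n; lia. Qed.

(** The upper bound on [r0] in linear form; it separates the lenses and keeps them away from 0 and
    1. *)
Lemma lens_gap : k%:R * r0 - r0 < 1.
Proof.
have k1 : 0 < (k - 1)%:R :> R by rewrite ltr0n; lia.
have := r0_lt; rewrite -[X in _ < X]mulr1 ltr_pdivlMl // natrB; last by lia.
by rewrite mulrBl mul1r.
Qed.

Lemma lens_startE j : (j <= k)%N -> s j = 1 - k%:R * r0 + j%:R * r0.
Proof. by move=> jk; rewrite /s natrB //; ring. Qed.

Lemma r0_gt0 : 0 < r0.
Proof. by apply: lt_trans r0_gt; rewrite invr_gt0 ltr0n; lia. Qed.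

Lemma in_lensE j x : (j <= k)%N -> in_lens k r0 j x = in_cell L s j x.
Proof.
move=> jk; rewrite /in_lens /in_cell -/(s j); congr (_ && (_ < _)).
by rewrite lens_startE // /L; ring.
Qed.

Lemma lens_unit (j : nat) : j \in labs -> 0 < s j /\ s j + L < 1.
Proof.
rewrite mem_iota => jk; have jk' : (j <= k)%N by lia.
have gap := lens_gap; have r00 := r0_gt0.
rewrite lens_startE // /L.
have j1 : r0 <= j%:R * r0.
  by rewrite -[leLHS]mul1r ler_wpM2r ?(ltW r00) // ler1n; lia.
have jk1 : j%:R * r0 <= k%:R * r0 - r0.
  have -> : k%:R * r0 - r0 = (k - 1)%:R * r0 by rewrite natrB; [ring | lia].
  by rewrite ler_wpM2r ?(ltW r00) // ler_nat; lia.
by split; lra.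
Qed.

Lemma lens_disjoint (i j : nat) (x : R) : i \in labs -> j \in labs ->
  in_cell L s i x -> in_cell L s j x -> i = j.
Proof.
wlog : i j / (i <= j)%N.
  by move=> H il jl ix jx; case/orP: (leq_total i j) => ij; [|apply/esym]; apply: H.
rewrite !mem_iota leq_eqVlt => /predU1P[//|ij] il jl.
rewrite /in_cell !lens_startE; [|lia|lia].
move=> /andP[_ xi] /andP[jx _]; have gap := lens_gap; have r00 := r0_gt0.
have ij' : (i.+1)%:R * r0 <= j%:R * r0 by rewrite ler_wpM2r ?(ltW r00) // ler_nat.
by exfalso; move: ij' xi jx; rewrite /L -(addn1 i) natrD; lra.
Qed.

Local Notation cl := (classify L s labs).

Lemma classify_label (j : nat) (x : R) : j \in labs ->
  oapp (fun p => p.1 == j) false (cl x) = in_cell L s j x.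
Proof.
move=> jl; have [/hasP[i il ix]|/hasPn H] := boolP (has ((in_cell L s)^~ x) labs).
  rewrite (classify_in (iota_uniq _ _) lens_disjoint il ix) /=.
  by apply/eqP/idP => [<- //|jx]; exact: lens_disjoint ix jx.
by rewrite classify_notin //=; apply/esym/negbTE/H.
Qed.

Lemma classify_inj x y u : cl x = Some u -> cl y = Some u -> x = y.
Proof.
have cl_some z v : cl z = Some v -> v.2 = z - s v.1.
  have [/hasP[i il iz]|/hasPn H] := boolP (has ((in_cell L s)^~ z) labs).
    by rewrite (classify_in (iota_uniq _ _) lens_disjoint il iz) => -[<-].
  by rewrite classify_notin.
by move=> /cl_some ux /cl_some uy; apply: (@addIr _ (- s u.1)); rewrite -ux -uy.
Qed.

Lemma undup_classify xs : undup (pmap cl xs) = pmap cl (undup xs).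
Proof. by apply: undup_pmap => x y u _ _; exact: classify_inj. Qed.

Lemma lens_event_classify M xs : lens_event k r0 M xs =
  has_counts k.-1 M (unzip1 (undup (pmap cl xs))).
Proof.
rewrite undup_classify /lens_event /has_counts; apply: eq_in_all => j jl.
congr (_ == _); rewrite /mcount; elim: (undup xs) => //= x ys IH.
have := classify_label x jl; rewrite in_lensE; last by move: jl; rewrite mem_iota; lia.
by case: (cl x) => [p|] /= <-; rewrite IH.
Qed.

Lemma classify_vertices xs : undup (pmap cl xs) = pmap cl (vertices xs).
Proof.
have ends x : x = 0 \/ x = 1 -> cl x = None.
  move=> x01; apply: classify_notin => j /lens_unit[sj0 sj1]; rewrite /in_cell.
  by apply/negP; case: x01 => ->; lra.
rewrite -undup_classify [pmap cl (0 :: _)]/= (ends 0 (or_introl erefl)) /=.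
by rewrite (ends 1 (or_intror erefl)).
Qed.

(** A predecessor $y$ of $x$ on such a path satisfies $y < j r_0$ by [hop_paths_lt] and $y > x - r_0
    \ge s_j$, so it lies in lens $j$ with a larger offset than $x$. Conversely such a point is below
    $x$ and adjacent to it. The left end is included to admit $x = 1$. *)
Lemma hop_paths_chains xs j x : (j < k)%N -> s j.+1 <= x < j.+1%:R * r0 ->
  hop_paths r0 (vertices xs) j.+1 x = chains j (x - s j.+1) (undup (pmap cl xs)).
Proof.
have gap := lens_gap; have r00 := r0_gt0; have L0 := lens_length_gt0.
elim: j x => [|j IH] x jk /andP[sx xr].
  have V0 : 0 \in vertices xs by rewrite mem_undup mem_head.
  have x0 : adj r0 0 x.
    move: sx xr; rewrite mul1r lens_startE // mul1r => sx xr.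
    have x0 : 0 < x by lra.
    by rewrite /adj sub0r normrN gtr0_norm // lt_eqF.
  rewrite /= big_mkcond (bigD1_seq 0) ?undup_uniq //= x0 eqxx big1 // => y y0.
  by rewrite (negbTE y0) if_same.
have jl : j.+1 \in labs by rewrite mem_iota; lia.
have jk' : (j.+1 <= k)%N by lia.
have sS : s j.+2 = s j.+1 + r0.
  by rewrite !lens_startE // -(addn1 j.+1) natrD; ring.
rewrite classify_vertices -[LHS]/(\sum_(y <- _ | adj r0 y x) hop_paths _ _ j.+1 y)%N.
set hp := hop_paths _ _ j.+1.
rewrite /= [RHS]big_mkcond [RHS]big_pmap [LHS]big_mkcond /=. apply: eq_bigr => y _.
case: ifPn => [/andP[y_x yx]|nyx].
  (* A zero count does not exclude that [y] is in the lens; if it is, the induction hypothesis makes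
     its chain term 0 as well. *)
  have [y0|/hop_paths_lt yj] := eqVneq (hp y) 0%N.
    rewrite y0; have := classify_label y jl; case E : (cl y) => [p|] //= pj.
    case: ifP => // /andP[pj' xp].
    have jy : in_cell L s j.+1 y by rewrite -pj.
    move: y0; rewrite /hp IH //; last first.
      by move: jy; rewrite -in_lensE // /in_lens -/(s _) => /andP[/ltW -> ->].
    move: E; rewrite (classify_in (iota_uniq _ _) lens_disjoint jl jy) => -[<-] /= y0.
    by rewrite -classify_vertices y0.
  have jy : in_cell L s j.+1 y.
    rewrite -in_lensE // /in_lens -/(s _) yj andbT.
    by move: yx; rewrite ltr_norml; lra.
  rewrite (classify_in (iota_uniq _ _) lens_disjoint jl jy) /= eqxx /=.
  rewrite ifT; last by move: yx; rewrite ltr_norml; lra.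
  rewrite /hp IH //; first by rewrite classify_vertices.
  by move: jy; rewrite -in_lensE // /in_lens -/(s _) => /andP[/ltW -> ->].
have := classify_label y jl; case E : (cl y) => [p|] //= pj.
case: ifP => // /andP[pj' xp]; case/negP: nyx.
have jy : in_cell L s j.+1 y by rewrite -pj.
move: E xp; rewrite (classify_in (iota_uniq _ _) lens_disjoint jl jy) => -[<-] /= xp.
have xy : y < x.
  move: jy; rewrite -in_lensE // /in_lens => /andP[_ yj].
  apply: lt_le_trans yj (le_trans _ sx).
  by rewrite lens_startE // -(addn1 j.+1) natrD; lra.
by rewrite /adj lt_eqF //= distrC gtr0_norm ?subr_gt0 //; lra.
Qed.

Lemma sigma_chains xs : sigma k r0 xs = chains k.-1 0 (undup (pmap cl xs)).
Proof.
have k1 : k.-1.+1 = k by lia.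
(* The endpoint 1 is the left end of the next interval in the progression of lenses, hence has
   offset 0. *)
have sk : s k = 1 by rewrite lens_startE // subrK.
have := @hop_paths_chains xs k.-1 1; rewrite k1 sk subrr sigma_hop_paths; apply.
  by lia.
by rewrite lexx /= -subr_gt0 lens_length_gt0.
Qed.

End Lenses.

(** * The Poisson mixture *)

Lemma has_counts_size d M c : all (mem (iota 1 d)) c -> has_counts d M c ->
  size c = (\sum_(1 <= i < d.+1) M i)%N.
Proof.
elim: d c => [|d IH] c; first by rewrite big_geq //; case: c.
move=> cd; rewrite has_countsS big_nat_recr //= => /andP[/eqP <- Hc].
rewrite -(IH _ _ Hc).
  by rewrite size_filter addnC -(count_predC (pred1 d.+1)).
rewrite all_filter; apply: sub_all cd => x /=; rewrite !inE !mem_iota.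
by case: eqVneq => //=; lia.
Qed.

Section PoissonMixture.
Variable R : realType.

(** The [n]-point term of the Poisson expectation, up to the factor [word_sum]. *)
Definition poisson_term (lam p L : R) N n : R :=
  expR (- lam) * lam ^+ n / n`!%:R * ('C(n, N)%:R * p ^+ (n - N) * L ^+ N).

(** Terms with [n < N] vanish; shifted by [N], the series is a multiple of the exponential series at
    [lam * p]. *)
Lemma poisson_term_cvg (lam p L : R) N :
  (series (poisson_term lam p L N) @ \oo -->
   expR (- lam) * (lam * L) ^+ N / N`!%:R * expR (lam * p))%classic.
Proof.
rewrite -(cvg_shiftn N).
have -> : (fun n => series (poisson_term lam p L N) (n + N)%N) =
    (fun n => expR (- lam) * (lam * L) ^+ N / N`!%:R * series (exp_coeff (lam * p)) n).
  apply/funext => n; rewrite /series /= (@big_cat_nat _ _ _ N) //=; last exact: leq_addl.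
  rewrite big_nat big1 ?add0r => [|i /andP[_ iN]]; last first.
    by rewrite /poisson_term bin_small // !mul0r mulr0.
  rewrite -{1}[N]add0n big_addn addnK mulr_sumr; apply: eq_bigr => i _.
  rewrite /poisson_term /exp_coeff addnK.
  have := bin_fact (leq_addl i N); rewrite addnK => <-.
  rewrite /= !natrM !exprMn exprD; field.
  by rewrite !pnatr_eq0 -!lt0n !fact_gt0 bin_gt0 leq_addl.
apply: cvgMr; exact: is_cvg_series_exp_coeff.
Qed.

End PoissonMixture.

Section PoissonLenses.
Variables (R : realType) (r0 : R) (k : nat).
Hypothesis k2 : (2 <= k)%N.
Hypothesis r0_gt : k%:R^-1 < r0.
Hypothesis r0_lt : r0 < (k - 1)%:R^-1.
Variable M : nat -> nat.
Local Notation L := (lens_length r0 k).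
Local Notation s := (lens_start r0 k).
Local Notation labs := (iota 1 k.-1).
Local Notation N := (\sum_(1 <= i < k.-1.+1) M i)%N.

Definition word_sum (q : R) : R :=
  seqsum N labs (fun c => (has_counts k.-1 M c)%:R * q ^+ embed k.-1 c).

Lemma cube_int_lens q n :
  cube_int n (fun xs => q ^+ sigma k r0 xs * (lens_event k r0 M xs)%:R) =
  'C(n, N)%:R * (1 - k.-1%:R * L) ^+ (n - N) * L ^+ N * word_sum q.
Proof.
have L0 := lens_length_gt0 k2 r0_gt r0_lt.
transitivity (cube_int n (fun xs => chain_weight k.-1 M q (pmap (classify L s labs) xs))).
  congr cube_int; apply/funext => xs.
  by rewrite sigma_chains // lens_event_classify // mulrC.
have s0 j : j \in labs -> 0 <= s j /\ s j + L <= 1.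
  by move=> /(lens_unit k2 r0_gt r0_lt)[/ltW ? /ltW ?].
rewrite (cube_int_classify L0 s0 (iota_uniq _ _) (lens_disjoint k2 r0_gt r0_lt));
  last exact: chain_weight_nice.
rewrite size_iota.
(* The event prescribes the total number [N] of lens points, so only [m = N] survives. *)
have intE m : labelled_int L labs m (chain_weight k.-1 M q) =
    if m == N then word_sum q * L ^+ N else 0.
  rewrite (labelled_int_const L0 (Z := if m == N then word_sum q else 0)).
  - by case: eqP => [->|]; rewrite ?mul0r.
  - exact: chain_weight_nice.
  move=> a sz ua /allP aL; rewrite -{1}sz sum_chain_weight //; last first.
    by apply/allP => x /aL /andP[].
  case: eqP => [mN|mN]; first by rewrite sz mN.
  rewrite -[RHS](seqsum0 _ m labs) sz; apply: eq_in_seqsum => c cm cl.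
  case: (boolP (has_counts _ _ _)) => [/(has_counts_size cl)|]; last by rewrite mul0r.
  by rewrite cm.
transitivity (\sum_(m < n.+1) 'C(n, m)%:R * (1 - k.-1%:R * L) ^+ (n - m) *
    (if (m : nat) == N then word_sum q * L ^+ N else 0)).
  by apply: eq_bigr => m _; congr (_ * _); exact: intE.
have [Nn|nN] := ltnP N n.+1.
  rewrite (bigD1 (Ordinal Nn)) //= eqxx [X in _ + X]big1 => [|i iN]; last first.
    by rewrite ifN ?mulr0.
  by rewrite addr0 -!mulrA [L ^+ _ * _]mulrC.
rewrite bin_small // !mul0r [LHS]big1 // => i _.
by rewrite ifN ?mulr0 // neq_ltn (leq_trans (ltn_ord i) nN).
Qed.

Lemma ppp_expect_lens lam q :
  ppp_expect lam (fun xs => q ^+ sigma k r0 xs * (lens_event k r0 M xs)%:R) =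
  expR (- lam) * (lam * L) ^+ N / N`!%:R * expR (lam * (1 - k.-1%:R * L)) * word_sum q.
Proof.
rewrite /ppp_expect; apply: cvg_lim => //.
have -> : (fun m => \sum_(0 <= n < m) (expR (- lam) * lam ^+ n / n`!%:R *
    cube_int n (fun xs => q ^+ sigma k r0 xs * (lens_event k r0 M xs)%:R))) =
    (fun m => series (poisson_term lam (1 - k.-1%:R * L) L N) m * word_sum q).
  apply/funext => m; rewrite /series /= mulr_suml; apply: eq_bigr => n _.
  by rewrite cube_int_lens /poisson_term !mulrA.
by apply: cvgMl; exact: poisson_term_cvg.
Qed.

End PoissonLenses.

Theorem theorem2p2 (R : realType) (lam r0 q : R) (k : nat) (M : nat -> nat) :
  (3 <= k)%N -> 0 < lam ->
  (k%:R)^-1 < r0 -> r0 < ((k - 1)%:R)^-1 ->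
  ppp_cond_expect lam (fun xs => q ^+ sigma k r0 xs) (lens_event k r0 M)
  = rhs22 k q M.
Proof.
move=> k3 lam0 r0_gt r0_lt; have k2 : (2 <= k)%N by lia.
have L0 := lens_length_gt0 k2 r0_gt r0_lt.
rewrite /ppp_cond_expect ppp_expect_lens //.
(* The probability of the event is the same expectation at [q = 1]. *)
have -> : (fun xs => (lens_event k r0 M xs)%:R) =
    (fun xs => 1 ^+ sigma k r0 xs * (lens_event k r0 M xs)%:R) :> (seq R -> R).
  by apply/funext => xs; rewrite expr1n mul1r.
rewrite ppp_expect_lens //.
have -> : word_sum k M 1 = multinom R k M.
  rewrite -{2}(_ : k.-1.+1 = k) -?sum_words_multinom; last by lia.
  by apply: eq_seqsum => c; rewrite expr1n mulr1.
have mn0 : multinom R k M != 0.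
  rewrite /multinom mulf_neq0 // ?invr_eq0 pnatr_eq0 -lt0n ?fact_gt0 //.
  by rewrite prodn_gt0 // => i; exact: fact_gt0.
have -> : word_sum k M q = multinom R k M * rhs22 k q M.
  rewrite /rhs22 mulrA divff // mul1r.
  have k1 : k.-1 = (k - 2).+1 by lia.
  by rewrite /word_sum k1 -sum_words_gaps //; lia.
(* The Poisson factor shared by numerator and denominator; it is nonzero because [lam] and the lens
   length are positive. *)
set kappa := (X in X * (multinom R k M * _)).
have kappa0 : kappa != 0.
  by rewrite !mulf_neq0 ?gt_eqF ?expR_gt0 // ?exprn_gt0 ?mulr_gt0 // invr_gt0.
by rewrite -/kappa [kappa * (_ * _)]mulrA mulrAC divff ?mul1r // mulf_neq0.
Qed.
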